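(* Let $\mathscr{V}$ be a Hilbert $\mathscr{A}$-module over a $C^*$-algebra $\mathscr{A}$ and let $\mathbb{L}(\mathscr{V})$ be its linking algebra. For every $x\in\mathscr{V}$, $$\frac{1}{8}\Big(4\|x\|+2|\Gamma-\Gamma'|+\Delta+\Delta'\Big)\le \Omega(x),$$ where $$\Gamma=\max\left\{\|x\|,\left\|\begin{bmatrix}0&l_x\\ r_x&0\end{bmatrix}\right\|\right\},\qquad \Gamma'=\max\left\{\|x\|,\left\|\begin{bmatrix}0&-l_x\\ r_x&0\end{bmatrix}\right\|\right\},$$ $$\Delta=\left|\,\|x\|-\left\|\begin{bmatrix}0&l_x\\ r_x&0\end{bmatrix}\right\|\,\right|,\qquad \Delta'=\left|\,\|x\|-\left\|\begin{bmatrix}0&-l_x\\ r_x&0\end{bmatrix}\right\|\,\right|,$$ and the norms of matrices are those of $\mathbb{L}(\mathscr{V})$.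
   Context: $\mathscr{A}$ is a nonzero (not necessarily unital) complex $C^*$-algebra. A Hilbert $\mathscr{A}$-module $\mathscr{V}$ is a right $\mathscr{A}$-module with an $\mathscr{A}$-valued inner product $\langle\cdot,\cdot\rangle$ that is $\mathbb{C}$-linear and $\mathscr{A}$-linear in the second variable, so that $\langle x, ya\rangle=\langle x,y\rangle a$, and that satisfies $\langle x,y\rangle^*=\langle y,x\rangle$ and $\langle x,x\rangle\ge 0$ with equality iff $x=0$. It is complete in the norm $\|x\|=\|\langle x,x\rangle\|^{1/2}$. $\mathscr{A}$ is a Hilbert module over itself with $\langle a,b\rangle=a^*b$. For Hilbert $\mathscr{A}$-modules $\mathscr{V},\mathscr{W}$, $\mathbb{B}(\mathscr{V},\mathscr{W})$ is the space of adjointable maps and $\mathbb{K}(\mathscr{V},\mathscr{W})$ is the closed linear span in it of the maps $\theta_{x,y}(z)=x\langle y,z\rangle$ ($x\in\mathscr{W}$, $y\in\mathscr{V}$); $\mathbb{K}(\mathscr{V})=\mathbb{K}(\mathscr{V},\mathscr{V})$. For $a\in\mathscr{A}$ let $T_a\in\mathbb{K}(\mathscr{A})$ be $T_a(b)=ab$. For $x\in\mathscr{V}$ let $r_x\in\mathbb{K}(\mathscr{A},\mathscr{V})$ be $r_x(a)=xa$ and $l_x\in\mathbb{K}(\mathscr{V},\mathscr{A})$ be $l_x(y)=\langle x,y\rangle$, so $r_x^*=l_x$. The linking algebra of $\mathscr{V}$ is the $C^*$-algebra $\mathbb{L}(\mathscr{V})=\left\{\begin{bmatrix} T_a & l_y\\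 r_x & T\end{bmatrix}: a\in\mathscr{A},\ x,y\in\mathscr{V},\ T\in\mathbb{K}(\mathscr{V})\right\}=\mathbb{K}(\mathscr{A}\oplus\mathscr{V})$, acting on $\mathscr{A}\oplus\mathscr{V}$ by matrix multiplication on column vectors, with the operator norm. $\mathcal{S}(\mathbb{L}(\mathscr{V}))$ is the set of states (positive linear functionals of norm $1$) of $\mathbb{L}(\mathscr{V})$. The numerical radius of $x\in\mathscr{V}$ is $\Omega(x)=\sup\left\{\left|\varphi\left(\begin{bmatrix}0&0\\ r_x&0\end{bmatrix}\right)\right|:\varphi\in\mathcal{S}(\mathbb{L}(\mathscr{V}))\right\}$. *)

(* Defs.v *)
From HB Require Import structures.
From mathcomp Require Import all_boot all_order all_algebra.
From mathcomp Require Import complex.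
From mathcomp Require Import all_classical all_reals all_analysis.

Set Implicit Arguments.
Unset Strict Implicit.
Unset Printing Implicit Defensive.

Import Order.TTheory GRing.Theory Num.Theory.
Import numFieldNormedType.Exports.

Local Open Scope classical_set_scope.
Local Open Scope ring_scope.
Local Open Scope complex_scope.

(* The multiplication is part of the mixin because the ring structures of the
   library are unital, while a C*-algebra need not be. *)
HB.mixin Record CompleteNormedModule_isCStarAlgebra (R : realType) (A : Type)
    of CompleteNormedModule R[i] A := {
  cmul : A -> A -> A;
  cstar : A -> A;
  cmulA : forall a b c : A, cmul a (cmul b c) = cmul (cmul a b) c;
  cmulDl : forall a b c : A, cmul (a + b) c = cmul a c + cmul b c;
  cmulDr : forall a b c : A, cmul a (b + c) = cmul a b + cmul a c;
  cmulZl : forall (k : R[i]) (a b : A), cmul (k *: a) b = k *: cmul a b;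
  cmulZr : forall (k : R[i]) (a b : A), cmul a (k *: b) = k *: cmul a b;
  cstarD : forall a b : A, cstar (a + b) = cstar a + cstar b;
  cstarZ : forall (k : R[i]) (a : A), cstar (k *: a) = k^* *: cstar a;
  cstarM : forall a b : A, cstar (cmul a b) = cmul (cstar b) (cstar a);
  cstarK : forall a : A, cstar (cstar a) = a;
  normr_cmul : forall a b : A, `|cmul a b| <= `|a| * `|b|;
  normr_cstarM : forall a : A, `|cmul (cstar a) a| = `|a| ^+ 2
}.

#[short(type="cstarAlgType")]
HB.structure Definition CStarAlgebra (R : realType) :=
  {A of CompleteNormedModule R[i] A
      & CompleteNormedModule_isCStarAlgebra R A}.

Definition cpositive (R : realType) (A : cstarAlgType R) (a : A) : Prop :=
  exists b : A, a = cmul (cstar b) b.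

(* The norm of the module is tied to the inner product by normr_inner, so that
   completeness is completeness for ||<x, x>||^(1/2). *)
HB.mixin Record CompleteNormedModule_isHilbertModule (R : realType)
    (A : cstarAlgType R) (V : Type) of CompleteNormedModule R[i] V := {
  ract : V -> A -> V;
  inner : V -> V -> A;
  ractDl : forall (x y : V) (a : A), ract (x + y) a = ract x a + ract y a;
  ractDr : forall (x : V) (a b : A), ract x (a + b) = ract x a + ract x b;
  ractA : forall (x : V) (a b : A), ract x (cmul a b) = ract (ract x a) b;
  ractZl : forall (k : R[i]) (x : V) (a : A),
    ract (k *: x) a = k *: ract x a;
  ractZr : forall (k : R[i]) (x : V) (a : A),
    ract x (k *: a) = k *: ract x a;
  innerDr : forall x y z : V, inner x (y + z) = inner x y + inner x z;
  innerZr : forall (k : R[i]) (x y : V), inner x (k *: y) = k *: inner x y;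
  inner_ract : forall (x y : V) (a : A),
    inner x (ract y a) = cmul (inner x y) a;
  cstar_inner : forall x y : V, cstar (inner x y) = inner y x;
  inner_positive : forall x : V, cpositive (inner x x);
  inner_eq0 : forall x : V, inner x x = 0 <-> x = 0;
  normr_inner : forall x : V, `|x| ^+ 2 = `|inner x x|
}.

#[short(type="hilbertModType")]
HB.structure Definition HilbertModule (R : realType) (A : cstarAlgType R) :=
  {V of CompleteNormedModule R[i] V
      & CompleteNormedModule_isHilbertModule R A V}.

(* The norm of a normed module over R[i] has its values in R[i]; they are
   nonnegative reals, and rnorm reads them in R. *)
Definition rnorm (R : realType) (M : normedModType R[i]) (x : M) : R :=
  complex.Re `|x|.

Section Compact.
Context {R : realType} {A : cstarAlgType R} {V W : hilbertModType A}.

Definition adjointable (T : V -> W) : Prop :=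
  exists S : W -> V, forall (x : V) (y : W), inner (T x) y = inner x (S y).

Definition theta (x : W) (y : V) : V -> W := fun z => ract x (inner y z).

Definition theta_span : set (V -> W) :=
  [set S | exists n (c : 'I_n -> R[i]) (x : 'I_n -> W) (y : 'I_n -> V),
     S = \sum_(i < n) c i *: theta (x i) (y i)].

(* K(V, W): the closure of the span for the operator norm, where
   ||T - S|| <= e is written out. *)
Definition compact_op : set (V -> W) :=
  [set T | adjointable T /\
     forall e : R, 0 < e -> exists2 S, theta_span S &
       forall z : V, rnorm (T z - S z) <= e * rnorm z].

End Compact.

Section LinkingAlgebra.
Context {R : realType} {A : cstarAlgType R} {V : hilbertModType A}.

Definition T_ (a : A) : A -> A := fun b => cmul a b.
Definition r_ (x : V) : A -> V := fun a => ract x a.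
Definition l_ (x : V) : V -> A := fun y => inner x y.

(* The pairs A * V carry the Hilbert module structure of the direct sum of A
   and V; the norm that the library puts on the product type is not used. *)
Definition dsum_inner (u v : A * V) : A :=
  cmul (cstar u.1) v.1 + inner u.2 v.2.

Definition dsum_norm (u : A * V) : R := Num.sqrt (rnorm (dsum_inner u u)).

Definition mx2 (P : A -> A) (Q : V -> A) (S : A -> V) (T : V -> V) :
    A * V -> A * V :=
  fun u => (P u.1 + Q u.2, S u.1 + T u.2).

Definition op_norm (F : A * V -> A * V) : R :=
  sup [set dsum_norm (F u) | u in [set u | dsum_norm u <= 1]].

Definition is_adjoint (F G : A * V -> A * V) : Prop :=
  forall u v : A * V, dsum_inner (F u) v = dsum_inner u (G v).

End LinkingAlgebra.

Section NumericalRadius.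
Context {R : realType} {A : cstarAlgType R} (V : hilbertModType A).

Definition linking : set (A * V -> A * V) :=
  [set F | exists (a : A) (x y : V) (T : V -> V),
     compact_op T /\ F = mx2 (T_ a) (l_ y) (r_ x) T].

Definition linking_positive (F : A * V -> A * V) : Prop :=
  exists G H, [/\ linking G, linking H, is_adjoint G H & F = H \o G].

(* A functional on the linking algebra is represented by a function defined on
   all maps A * V -> A * V, whose values outside of linking are irrelevant. *)
Definition states : set ((A * V -> A * V) -> R[i]) :=
  [set phi |
    [/\ forall (k : R[i]) F G, linking F -> linking G ->
          phi (k *: F + G) = k * phi F + phi G,
        forall F, linking_positive F -> 0 <= phi F &
        sup [set complex.Re `|phi F| | F in
               [set F | linking F /\ op_norm F <= 1]] = 1]].

Definition Omega (x : V) : R :=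
  sup [set complex.Re `|phi (mx2 0 0 (r_ x) 0)| | phi in states].

End NumericalRadius.

(* Main.v *)
(** The matrices [0, l_x; r_x, 0] and [0, -l_x; r_x, 0] both have norm [||x||], so
    the claim is [||x|| / 2 <= Omega x]. Put [h = <x, x>] and, for [||x|| = 1], let
    [tau] be a state of [A] norming the positive element [h^3 = <xh, xh>]; for
    [u = (h, xh)] the functional [F |-> tau <u, F u> / 2] is a state of the linking
    algebra whose value at the corner [r_x] is [tau (h^3) / 2 = 1 / 2].

    Norming states come from the Hahn-Banach theorem as soon as the norm is
    monotone on positive elements. In the unitization call [y = y^*] positive when
    [||t - y|| <= t] for some [t >= 0]; these elements form a convex cone, and the
    iteration [v |-> (1 - y + v^2) / 2] makes them exactly the squares of
    self-adjoint elements. To see that [a = c^* c] is positive, let [r] be the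
    square root of [a^2] and [n = r - a]: then [d = c n] satisfies [d^* d = - f^2]
    with [f] self-adjoint, which forces [d = 0], then [n = 0] and [a = r]. *)

From HB Require Import structures.
Require Import Defs.
From mathcomp Require Import all_boot all_order all_algebra.
From mathcomp Require Import complex.
From mathcomp Require Import all_classical all_reals all_analysis.
From mathcomp Require Import lra ring.

Set Implicit Arguments.
Unset Strict Implicit.
Unset Printing Implicit Defensive.

Import Order.TTheory GRing.Theory Num.Theory.
Import numFieldNormedType.Exports.
Import Normc.

Local Open Scope classical_set_scope.
Local Open Scope complex_scope.
Local Open Scope ring_scope.

(** * Real-valued norms and completeness with an explicit rate *)

Section RealNorm.
Context {R : realType} {M : normedModType R[i]}.
Implicit Types (x y : M) (k : R[i]) (t : R).

Lemma normc_real t : normc t%:C = `|t|.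
Proof. by rewrite /= expr0n addr0 sqrtr_sqr. Qed.

Lemma ger0_normc t : 0 <= t -> normc t%:C = t.
Proof. by move=> t0; rewrite normc_real ger0_norm. Qed.

Lemma conjC_real t : t%:C^* = t%:C.
Proof. exact: conjc_real. Qed.

Lemma normc_ge0 k : 0 <= normc k.
Proof. by case: k => a b; exact: sqrtr_ge0. Qed.

Lemma rnormE x : `|x| = (rnorm x)%:C.
Proof. by rewrite /rnorm RRe_real // realE normr_ge0. Qed.

Lemma rnorm_ge0 x : 0 <= rnorm x.
Proof. by rewrite -ler0c -rnormE. Qed.

Lemma rnorm0 : rnorm (0 : M) = 0.
Proof. by rewrite /rnorm normr0. Qed.

Lemma rnorm0_eq0 x : rnorm x = 0 -> x = 0.
Proof. by move=> x0; apply/normr0_eq0; rewrite rnormE x0. Qed.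

Lemma ler_rnormD x y : rnorm (x + y) <= rnorm x + rnorm y.
Proof.
by rewrite -lecR -rnormE raddfD /= -!rnormE ler_normD.
Qed.

Lemma rnormZ k x : rnorm (k *: x) = normc k * rnorm x.
Proof.
by apply: complexI; rewrite -rnormE normrZ rmorphM /= -rnormE.
Qed.

Lemma rnormZr t x : 0 <= t -> rnorm (t%:C *: x) = t * rnorm x.
Proof. by move=> t0; rewrite rnormZ ger0_normc. Qed.

End RealNorm.

Lemma scale_half (R : realType) (V : lmodType R[i]) (v : V) :
  (2^-1)%:C *: (v + v) = v.
Proof. by rewrite scalerDr -scalerDl -rmorphD -div1r -splitr scale1r. Qed.

(** The bound [d k] controls all later terms, so it passes to the limit unchanged. The explicit rate
    lets limits be taken componentwise in the unitization, where size is measured by bounds and not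
    by a norm. *)
Lemma complete_sequence (K : numFieldType) (M : completeNormedModType K)
    (v : nat -> M) (d : nat -> K) :
  (forall k m, (k <= m)%N -> `|v m - v k| <= d k) ->
  (forall e : K, 0 < e -> exists k, d k < e) ->
  exists w : M, forall k, `|w - v k| <= d k.
Proof.
move=> vd d0.
have cv : cvg (v @ \oo).
  apply/cauchy_cvgP/cauchy_exP => e e0.
  have [k dk] := d0 e e0; exists (v k).
  exists k => // m /= km; rewrite -ball_normE /=.
  by rewrite distrC (le_lt_trans _ dk)// vd.
exists (lim (v @ \oo)) => k.
have /cvgrPdist_le/(_ _ _) lv := cv.
apply/ler_addgt0Pr => e e0.
have [m _ vm] := lv e e0.
have := vm (maxn m k) (leq_maxl _ _).
have := vd _ _ (leq_maxr m k) => h1 h2.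
rewrite -(subrKA (v (maxn m k))).
by rewrite (le_trans (ler_normD _ _))// addrC lerD.
Qed.

(** * Elementary identities in a C*-algebra *)

Section CStar.
Context {R : realType} {A : cstarAlgType R}.
Implicit Types (a b c : A) (k : R[i]) (t : R).

Lemma cmul0l a : cmul 0 a = 0.
Proof. by rewrite -[X in cmul X _](scale0r (0:A)) cmulZl scale0r. Qed.

Lemma cmul0r a : cmul a 0 = 0.
Proof. by rewrite -[X in cmul _ X](scale0r (0:A)) cmulZr scale0r. Qed.

Lemma cmulNl a b : cmul (- a) b = - cmul a b.
Proof. by rewrite -scaleN1r cmulZl scaleN1r. Qed.

Lemma cmulNr a b : cmul a (- b) = - cmul a b.
Proof. by rewrite -scaleN1r cmulZr scaleN1r. Qed.

Lemma cstar0 : cstar (0 : A) = 0.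
Proof. by have := cstarZ (0 : R[i]) (0 : A); rewrite !scale0r conjC0 scale0r. Qed.

Lemma cstarN a : cstar (- a) = - cstar a.
Proof. by rewrite -scaleN1r cstarZ rmorphN1 scaleN1r. Qed.

Lemma rnorm_cmul a b : rnorm (cmul a b) <= rnorm a * rnorm b.
Proof. by rewrite -lecR rmorphM /= -!rnormE normr_cmul. Qed.

Lemma rnorm_cstarM a : rnorm (cmul (cstar a) a) = rnorm a ^+ 2.
Proof. by apply: complexI; rewrite rmorphXn /= -!rnormE normr_cstarM. Qed.

(** The C*-identity and submultiplicativity bound [rnorm b ^+ 2] by [rnorm (cstar b) * rnorm b];
    cancel [rnorm b] and use the result for [a] and for [cstar a]. *)
Lemma rnorm_cstar a : rnorm (cstar a) = rnorm a.
Proof.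
suff le b : rnorm b <= rnorm (cstar b).
  by apply/eqP; rewrite eq_le -{2}(cstarK a) !le.
have [->|b0] := eqVneq (rnorm b) 0; first exact: rnorm_ge0.
have bgt : 0 < rnorm b by rewrite lt_def b0 rnorm_ge0.
by rewrite -(ler_pM2r bgt) -expr2 -rnorm_cstarM rnorm_cmul.
Qed.

End CStar.

(** * The unitization of a C*-algebra *)

(** The pair [(k, a)] stands for [k + a]. Only the module structure of the product is copied; the
    multiplication is [umul]. *)
Definition unitization (R : realType) (A : cstarAlgType R) : Type :=
  (R[i]^o * A)%type.

HB.instance Definition _ (R : realType) (A : cstarAlgType R) :=
  GRing.Lmodule.copy (unitization A) (R[i]^o * A)%type.

Section UnitizationRing.
Context {R : realType} {A : cstarAlgType R}.
Implicit Types x y z : unitization A.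

Definition umul x y : unitization A :=
  (x.1 * y.1, x.1 *: y.2 + y.1 *: x.2 + cmul x.2 y.2).

Definition uone : unitization A := (1, 0).

Lemma umulA : associative umul.
Proof.
move=> [k a] [l b] [m c]; rewrite /umul /=; congr pair; first by rewrite mulrA.
rewrite !(scalerDr, cmulDl, cmulDr, cmulZl, cmulZr, cmulA, scalerA, addrA).
by rewrite (mulrC m k) (mulrC m l) [LHS](ACl (1*2*4*6*3*5*7))%AC.
Qed.

Lemma umul1l : left_id uone umul.
Proof.
by move=> [k a]; rewrite /umul /= mul1r scale1r scaler0 cmul0l !addr0.
Qed.

Lemma umul1r : right_id uone umul.
Proof.
by move=> [k a]; rewrite /umul /= mulr1 scale1r scaler0 cmul0r add0r addr0.
Qed.

Lemma umulDl : left_distributive umul +%R.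
Proof.
move=> [k a] [l b] [m c]; rewrite /umul /=; congr pair; first by rewrite mulrDl.
rewrite !(scalerDl, scalerDr, cmulDl, addrA).
by rewrite [LHS](ACl (1*3*5*2*4*6))%AC.
Qed.

Lemma umulDr : right_distributive umul +%R.
Proof.
move=> [k a] [l b] [m c]; rewrite /umul /=; congr pair; first by rewrite mulrDr.
rewrite !(scalerDl, scalerDr, cmulDr, addrA).
by rewrite [LHS](ACl (1*3*5*2*4*6))%AC.
Qed.

Lemma uone_neq0 : uone != 0.
Proof. by apply/eqP => -[/eqP]; rewrite oner_eq0. Qed.

End UnitizationRing.

HB.instance Definition _ (R : realType) (A : cstarAlgType R) :=
  GRing.Zmodule_isNzRing.Build (unitization A)
    umulA umul1l umul1r umulDl umulDr uone_neq0.

Section UnitizationAlgebra.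
Context {R : realType} {A : cstarAlgType R}.
Implicit Types x y z : unitization A.

Lemma uscaleAl (k : R[i]) x y : k *: (x * y) = k *: x * y.
Proof.
case: x y => [l a] [m b]; congr pair => /=; first exact: mulrA.
by rewrite !scalerDr !scalerA cmulZl (mulrC m k).
Qed.

Lemma uscaleAr (k : R[i]) x y : k *: (x * y) = x * (k *: y).
Proof.
case: x y => [l a] [m b]; congr pair => /=; first exact: mulrCA.
by rewrite !scalerDr !scalerA cmulZr (mulrC l k).
Qed.

End UnitizationAlgebra.

HB.instance Definition _ (R : realType) (A : cstarAlgType R) :=
  GRing.Lmodule_isLalgebra.Build R[i] (unitization A) uscaleAl.
HB.instance Definition _ (R : realType) (A : cstarAlgType R) :=
  GRing.Lalgebra_isAlgebra.Build R[i] (unitization A) uscaleAr.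

(** * Involution of the unitization and operator bounds *)

Section UnitizationCStar.
Context {R : realType} {A : cstarAlgType R}.
Implicit Types (x y z : unitization A) (a b : A) (k : R[i]) (s t M N : R).

Definition ustar x : unitization A := (x.1^*, cstar x.2).

(** Left multiplication by [x] on [A], which is an ideal of its unitization. *)
Definition uact x a : A := x.1 *: a + cmul x.2 a.

Definition uin a : unitization A := (0, a).

Definition ureal t : unitization A := t%:C *: 1.

Lemma ustarD x y : ustar (x + y) = ustar x + ustar y.
Proof. by congr pair; rewrite /= ?rmorphD ?cstarD. Qed.

Lemma ustarZ k x : ustar (k *: x) = k^* *: ustar x.
Proof. by congr pair; rewrite /= ?rmorphM ?cstarZ. Qed.

Lemma ustarN x : ustar (- x) = - ustar x.
Proof. by congr pair; rewrite /= ?rmorphN ?cstarN. Qed.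

Lemma ustarB x y : ustar (x - y) = ustar x - ustar y.
Proof. by rewrite ustarD ustarN. Qed.

Lemma ustarK : involutive ustar.
Proof. by case=> k a; rewrite /ustar /= conjCK cstarK. Qed.

Lemma ustar1 : ustar 1 = 1.
Proof. by rewrite /ustar /= conjC1 cstar0. Qed.

Lemma ustar0 : ustar 0 = 0.
Proof. by rewrite /ustar /= conjC0 cstar0. Qed.

Lemma ustarM x y : ustar (x * y) = ustar y * ustar x.
Proof.
case: x y => [k a] [l b]; congr pair => /=; first by rewrite rmorphM mulrC.
by rewrite !cstarD !cstarZ cstarM [in RHS](addrC (_ *: _)).
Qed.

Lemma ustar_real t : ustar (ureal t) = ureal t.
Proof. by rewrite /ureal ustarZ ustar1 conjC_real. Qed.

Lemma uactD x y a : uact (x + y) a = uact x a + uact y a.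
Proof. by rewrite /uact /= scalerDl cmulDl addrACA. Qed.

Lemma uactZ k x a : uact (k *: x) a = k *: uact x a.
Proof. by rewrite /uact /= scalerDr scalerA cmulZl. Qed.

Lemma uactM x y a : uact (x * y) a = uact x (uact y a).
Proof.
rewrite /uact /= !(cmulDl, cmulDr, scalerDr, cmulZl, cmulZr, scalerA, cmulA).
by rewrite !addrA.
Qed.

Lemma uact1 a : uact 1 a = a.
Proof. by rewrite /uact /= scale1r cmul0l addr0. Qed.

Lemma uact_in a b : uact (uin a) b = cmul a b.
Proof. by rewrite /uact /= scale0r add0r. Qed.

Lemma cmul_uact x a b : cmul (cstar (uact x a)) b = cmul (cstar a) (uact (ustar x) b).
Proof.
by rewrite /uact /= cstarD cstarZ cstarM cmulDl cmulDr cmulZl cmulZr cmulA.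
Qed.

(* Since the first component is kept, [ubound 0 x] forces [x = 0] even when
   [A] is already unital. *)
Definition ubound M x :=
  [/\ 0 <= M, normc x.1 <= M & forall a, rnorm (uact x a) <= M * rnorm a].

Lemma ubound_le M N x : M <= N -> ubound M x -> ubound N x.
Proof.
move=> MN [M0 x1 x2]; split; rewrite ?(le_trans _ MN)// => a.
by rewrite (le_trans (x2 a))// ler_wpM2r// rnorm_ge0.
Qed.

Lemma uboundD M N x y : ubound M x -> ubound N y -> ubound (M + N) (x + y).
Proof.
move=> [M0 x1 x2] [N0 y1 y2]; split; rewrite ?addr_ge0//.
  by rewrite (le_trans (le_normcD _ _))// lerD.
move=> a; rewrite uactD (le_trans (ler_rnormD _ _))// mulrDl lerD//.
Qed.

Lemma uboundZ M k x : ubound M x -> ubound (normc k * M) (k *: x).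
Proof.
have k0 := normc_ge0 k.
move=> [M0 x1 x2]; split; rewrite ?mulr_ge0//.
  by rewrite /= normcM ler_wpM2l.
by move=> a; rewrite uactZ rnormZ -mulrA ler_wpM2l.
Qed.

Lemma uboundZr M t x : 0 <= t -> ubound M x -> ubound (t * M) (t%:C *: x).
Proof. by move=> t0 /(uboundZ t%:C); rewrite ger0_normc. Qed.

Lemma uboundN M x : ubound M x -> ubound M (- x).
Proof.
by move=> /(uboundZ (-1)); rewrite normcN normc1 mul1r scaleN1r.
Qed.

Lemma uboundB M N x y : ubound M x -> ubound N y -> ubound (M + N) (x - y).
Proof. by move=> xM /uboundN yN; exact: uboundD. Qed.

Lemma uboundM M N x y : ubound M x -> ubound N y -> ubound (M * N) (x * y).
Proof.
move=> [M0 x1 x2] [N0 y1 y2]; split; rewrite ?mulr_ge0//.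
  rewrite /= normcM ler_pM ?normc_ge0//.
by move=> a; rewrite uactM (le_trans (x2 _))// -mulrA ler_wpM2l.
Qed.

Lemma ubound1 : ubound 1 1.
Proof.
split=> [//||a]; last by rewrite uact1 mul1r.
by rewrite (normc1 R : normc (1 : unitization A).1 = 1).
Qed.

Lemma ubound_real t : 0 <= t -> ubound t (ureal t).
Proof. by move=> t0; rewrite -[X in ubound X]mulr1; exact/uboundZr/ubound1. Qed.

Lemma ubound_exists x : exists M, ubound M x.
Proof.
have n0 := normc_ge0 x.1.
exists (normc x.1 + rnorm x.2); split; rewrite ?addr_ge0 ?ler_wpDr ?rnorm_ge0//.
move=> a; rewrite (le_trans (ler_rnormD _ _))// rnormZ mulrDl lerD2l.
exact: rnorm_cmul.
Qed.

(** Testing at [cstar a] turns the bound into [rnorm a ^+ 2 <= M * rnorm a]; the converse is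
    submultiplicativity. *)
Lemma ubound_inP M a : ubound M (uin a) <-> rnorm a <= M.
Proof.
split=> [[M0 _ aM]|aM].
  have := aM (cstar a); rewrite uact_in -{1}(cstarK a) rnorm_cstarM rnorm_cstar.
  have [->//|a0] := eqVneq (rnorm a) 0.
  by rewrite expr2 ler_pM2r// lt_def a0 rnorm_ge0.
have M0 : 0 <= M by rewrite (le_trans (rnorm_ge0 a)).
split=> //; first by rewrite [normc _](normc0 R).
by move=> b; rewrite uact_in (le_trans (rnorm_cmul _ _))// ler_wpM2r// rnorm_ge0.
Qed.

Lemma ubound0_eq0 x : ubound 0 x -> x = 0.
Proof.
case: x => k a [_ k0 ka]; have {}k0 : k = 0.
  by apply/eq0_normc/le_anti/andP; split; [exact: k0|exact: normc_ge0].
move: ka; rewrite {}k0 => ka; congr pair.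
apply: rnorm0_eq0; apply/eqP; rewrite eq_le rnorm_ge0 andbT.
by apply/ubound_inP; split=> //; rewrite [normc _](normc0 R).
Qed.

Lemma ubound_closed M x : (forall e, 0 < e -> ubound (M + e) x) -> ubound M x.
Proof.
move=> xM; have M0 : 0 <= M.
  by apply/ler_addgt0Pr => e /xM[]; rewrite addrC.
split=> //; first by apply/ler_addgt0Pr => e /xM[_ ? _].
move=> a; apply/ler_addgt0Pr => e e0.
(* For a fixed [a] the excess is taken as [e / (rnorm a + 1)], which contributes at most [e]. *)
have a1 : 0 < rnorm a + 1 by rewrite ltr_wpDl ?rnorm_ge0.
have [_ _ /(_ a) ha] := xM _ (divr_gt0 e0 a1).
rewrite (le_trans ha)// mulrDl lerD2l mulrAC ler_pdivrMr// ler_pM2l//.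
by rewrite lerDl.
Qed.

(** For [b = uact (ustar x) a], moving [ustar x] across the product gives
    [rnorm b ^+ 2 <= rnorm a * (M * rnorm b)]; cancel [rnorm b]. *)
Lemma ubound_star M x : ubound M x -> ubound M (ustar x).
Proof.
move=> [M0 x1 x2]; split=> //.
  by rewrite -lecR (_ : (normc _)%:C = `|x.1^*|)// norm_conjC lecR.
move=> a; set b := uact (ustar x) a.
have [->|b0] := eqVneq (rnorm b) 0; first by rewrite mulr_ge0 ?rnorm_ge0.
have bgt : 0 < rnorm b by rewrite lt_def b0 rnorm_ge0.
rewrite -(ler_pM2r bgt) -expr2 -rnorm_cstarM {1}/b cmul_uact ustarK.
rewrite (le_trans (rnorm_cmul _ _))// rnorm_cstar [leRHS]mulrAC [leRHS]mulrC.
by rewrite ler_wpM2l ?rnorm_ge0// x2.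
Qed.

(** The C*-identity for bounds: the square of [rnorm (uact x a)] is the norm of [cstar a] times
    [uact (ustar x * x) a]. *)
Lemma ubound_starM M x : 0 <= M -> ubound (M ^+ 2) (ustar x * x) -> ubound M x.
Proof.
move=> M0 [_ x1 x2]; split=> //.
  rewrite -(@ler_pXn2r _ 2)// ?nnegrE ?normc_ge0//.
  move: x1; rewrite /= normcM expr2.
  have -> // : normc x.1^* = normc x.1 by apply: complexI; exact: norm_conjC.
move=> a; rewrite -(@ler_pXn2r _ 2)// ?nnegrE ?rnorm_ge0 ?mulr_ge0 ?rnorm_ge0//.
rewrite -rnorm_cstarM cmul_uact -uactM (le_trans (rnorm_cmul _ _))//.
rewrite rnorm_cstar exprMn [in leRHS]expr2 mulrA (mulrC _ (rnorm a)).
by rewrite ler_wpM2l ?rnorm_ge0// x2.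
Qed.

End UnitizationCStar.

(** * Square roots in the unitization *)

(** Real and imaginary parts converge separately with rate [d]; recombining them costs at most the
    factor 2. *)
Lemma complex_complete_sequence (R : realType) (c : nat -> R[i]) (d : nat -> R) :
  (forall k m, (k <= m)%N -> normc (c m - c k) <= d k) ->
  (forall e : R, 0 < e -> exists k, d k < e) ->
  exists z : R[i], forall k, normc (z - c k) <= d k *+ 2.
Proof.
move=> cd d0.
have Re_le (z : R[i]) : `|complex.Re z| <= normc z by rewrite -lecR; exact: normc_ge_Re.
have Im_le (z : R[i]) : `|complex.Im z| <= normc z.
  (* The bound on real parts is transferred by multiplying with [- 'i]. *)
  have -> : complex.Im z = complex.Re (z * - 'i%C) by case: z => a b; rewrite /=; ring.
  rewrite (le_trans (Re_le _))// normcM normcN.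
  by rewrite [X in _ * X]/= expr0n expr1n add0r sqrtr1 mulr1.
have [a ha] : exists a : R, forall k, `|a - complex.Re (c k)| <= d k.
  apply: (@complete_sequence R R (fun k => complex.Re (c k)) d) => // k m km /=.
  by rewrite -raddfB (le_trans (Re_le _))// cd.
have [b hb] : exists b : R, forall k, `|b - complex.Im (c k)| <= d k.
  apply: (@complete_sequence R R (fun k => complex.Im (c k)) d) => // k m km /=.
  by rewrite -raddfB (le_trans (Im_le _))// cd.
exists (a +i* b)%C => k; have := ha k; have := hb k.
case: (c k) => p q /= hq hp.
rewrite -(ler_pXn2r (n := 2)) ?nnegrE ?sqrtr_ge0 ?mulrn_wge0 ?(le_trans _ hp)//.
rewrite sqr_sqrtr ?addr_ge0 ?sqr_ge0// -(real_normK (num_real (a - p))).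
rewrite -(real_normK (num_real (b - q))).
have := normr_ge0 (a - p); have := normr_ge0 (b - q); nra.
Qed.

Section Positive.
Context {R : realType} {A : cstarAlgType R}.
Implicit Types (x y z : unitization A) (s t M N e : R).

Lemma uin_snd x : uin x.2 = x - x.1 *: 1.
Proof.
case: x => k a; congr pair => /=; last by rewrite scaler0 subr0.
by rewrite [k *: _]mulr1 subrr.
Qed.

(** The second component is [x - x.1 *: 1], a difference of two elements bounded by [M]. *)
Lemma ubound_snd M x : ubound M x -> rnorm x.2 <= M *+ 2.
Proof.
move=> xM; apply/ubound_inP; rewrite uin_snd mulr2n; apply: uboundB => //.
case: xM => _ xM _; apply: ubound_le xM _.
by rewrite -[X in ubound X]mulr1; exact/uboundZ/ubound1.
Qed.

(** The scalar part and the part in [A] converge separately, each with rate [d k *+ 2]; hence the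
    factor 4. *)
Lemma ubound_complete (v : nat -> unitization A) (d : nat -> R) :
  (forall k m, (k <= m)%N -> ubound (d k) (v m - v k)) ->
  (forall e : R, 0 < e -> exists k, d k < e) ->
  exists w, forall k, ubound (d k *+ 4) (w - v k).
Proof.
move=> vd d0.
have [c hc] := @complex_complete_sequence R (fun k => (v k).1) d
  (fun k m km => let: And3 _ h _ := vd k m km in h) d0.
have [k m km|e e0|a ha] := @complete_sequence R[i] A (fun k => (v k).2)
    (fun k => (d k *+ 2)%:C).
- by rewrite rnormE lecR; apply: (ubound_snd (vd k m km)).
- have e_real : e = (complex.Re e)%:C by rewrite RRe_real// gtr0_real.
  have [|k dk] := d0 (complex.Re e / 2).
    by rewrite divr_gt0// -ltcR -e_real.
  by exists k; rewrite e_real ltcR mulr2n; lra.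
exists (c, a) => k.
have -> : (c, a) - v k = (c - (v k).1) *: 1 + uin (a - (v k).2).
  case: (v k) => l b; congr pair; rewrite /= ?scaler0 ?add0r//.
  by rewrite addr0 [_ *: 1]mulr1.
rewrite (_ : d k *+ 4 = d k *+ 2 * 1 + d k *+ 2); last by rewrite mulr1 -mulrnDr.
apply: uboundD.
  apply: ubound_le (uboundZ (c - (v k).1) ubound1).
  by rewrite ler_wpM2r.
by apply/ubound_inP; have := ha k; rewrite rnormE lecR.
Qed.

Lemma ubound_small x : (forall e, 0 < e -> ubound e x) -> x = 0.
Proof.
by move=> xe; apply/ubound0_eq0/ubound_closed => e e0; rewrite add0r; exact: xe.
Qed.

(** For a self-adjoint [x] the bound says that its spectrum lies in [[0, 2 t]], without mentioning
    spectra. *)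
Definition upos x :=
  ustar x = x /\ exists2 t, 0 <= t & ubound t (ureal t - x).

End Positive.

(** The right side exceeds the left by [2 (1 - z)^2]. With [z = x k], the left side is the error
    found below for the fixed-point equation. *)
Lemma half_sqr_rate (R : realFieldType) (z : R) :
  (1 - 2^-1 * (1 + z * z)) *+ 4 + 2^-1 * ((1 - z) *+ 4 * (1 + 1)) <= 8 * (1 - z).
Proof. have := sqr_ge0 (1 - z); rewrite expr2; lra. Qed.

Section Sqrt.
Context {R : realType} {A : cstarAlgType R}.
Variable y : unitization A.
Hypothesis y_sa : ustar y = y.
Hypothesis y1 : ubound 1 (1 - y).

Let half : R[i] := (2^-1)%:C.
Let w := 1 - y.
(** A fixed point [u] satisfies [u + u = w + u * u], that is [(1 - u) * (1 - u) = 1 - w = y]. *)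
Let v k := iter k (fun u => half *: (w + u * u)) 0.
(** The same iteration with [w] replaced by its bound 1. It majorizes [v] and the increments of [v],
    and it tends to 1. *)
Let x k : R := iter k (fun u => 2^-1 * (1 + u * u)) 0.

Let vS k : v k.+1 = half *: (w + v k * v k). Proof. by []. Qed.

Let xS k : x k.+1 = 2^-1 * (1 + x k * x k). Proof. by []. Qed.

Let x01 k : 0 <= x k <= 1.
Proof.
elim: k => [|k /andP[k0 k1]]; first by rewrite lexx ler01.
by rewrite xS; apply/andP; split; nra.
Qed.

Let v_comm c k : GRing.comm c w -> GRing.comm c (v k).
Proof.
move=> cw; elim: k => [|k ck]; first exact: commr0.
rewrite vS /GRing.comm -scalerAr -scalerAl; congr (_ *: _).
by apply: commrD => //; exact: commrM.
Qed.

Let v_sa k : ustar (v k) = v k.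
Proof.
elim: k => [|k ck]; first exact: ustar0.
by rewrite vS ustarZ conjC_real ustarD ustarM ck ustarB ustar1 y_sa.
Qed.

Let v_bound k : ubound (x k) (v k).
Proof.
elim: k => [|k ck]; first by apply/ubound_inP; rewrite rnorm0.
rewrite vS xS; apply: uboundZr => //; apply: uboundD => //; exact: uboundM.
Qed.

(** Consecutive iterates commute, so a difference of squares factors as
    [(v k.+1 - v k) * (v k.+1 + v k)]; the same factorization of [x] carries the majorant along. *)
Let v_step k : ubound (x k.+1 - x k) (v k.+1 - v k).
Proof.
elim: k => [|k ck].
  rewrite vS xS /= !mulr0 !addr0 !subr0; exact: uboundZr.
have -> : x k.+2 - x k.+1 = 2^-1 * ((x k.+1 - x k) * (x k.+1 + x k)).
  by rewrite (xS k.+1) {3}(xS k); ring.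
have -> : v k.+2 - v k.+1 = half *: ((v k.+1 - v k) * (v k.+1 + v k)).
  have cv : GRing.comm (v k.+1) (v k).
    by apply: v_comm; apply: commr_sym; exact: v_comm.
  rewrite (vS k.+1) {3}(vS k) -scalerBr; congr (_ *: _).
  by rewrite opprD addrACA subrr add0r mulrDr !mulrBl cv addrA subrK.
apply: uboundZr => //.
by apply: uboundM => //; exact: uboundD.
Qed.

Let v_dist k m : (k <= m)%N -> ubound (1 - x k) (v m - v k).
Proof.
move=> km; apply: (@ubound_le _ _ (x m - x k)).
  by have := x01 m; lra.
rewrite -(subnK km); elim: (m - k)%N => [|n IH].
  by rewrite add0n !subrr; apply/ubound_inP; rewrite rnorm0.
rewrite addSn -(subrKA (x (n + k)%N)) -(subrKA (v (n + k)%N)).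
exact: uboundD (v_step _) IH.
Qed.

Let x_rate k : 1 - x k <= 2 / (k.+1)%:R.
Proof.
elim: k => [|k IH]; first by rewrite /= subr0 divr1 ler1n.
have k0 : 0 < k.+1%:R :> R by rewrite ltr0n.
have /andP[xk0 xk1] := x01 k.
have {}IH : (1 - x k) * k.+1%:R <= 2 by rewrite -ler_pdivlMr.
rewrite ler_pdivlMr ?ltr0n// -natr1 xS.
set z := x k in IH xk0 xk1 *; set n := k.+1%:R in IH k0 *.
(* The goal is [(1 - z^2) (n + 1) <= 4]. This product gives [(1 - z^2) n <= 2 (1 + z)], and
   [2 (1 + z) + 1 - z^2 <= 4] because [(1 - z)^2 >= 0]. *)
have : 0 <= (1 + z) * (2 - (1 - z) * n) by rewrite mulr_ge0 ?subr_ge0// addr_ge0.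
nra.
Qed.

Let x_lim e : 0 < e -> exists k, 1 - x k < e.
Proof.
move=> e0; have [k ke] : exists k, 2 / k.+1%:R < e.
  exists (Num.trunc (2 / e)).
  rewrite ltr_pdivrMr ?ltr0n// mulrC -ltr_pdivrMr//.
  by rewrite truncnS_gt.
by exists k; rewrite (le_lt_trans (x_rate k)).
Qed.

(** The root is [1 - u] for the limit [u] of [v]. Each property of [u] is inherited from the
    iterates, the equalities by bounding a difference by a multiple of [1 - x k]. *)
Lemma usqrt_contraction : exists b, [/\ ustar b = b, b * b = y, ubound 1 (1 - b) &
  forall c, GRing.comm c y -> GRing.comm c b].
Proof.
have [u hu] := ubound_complete v_dist x_lim.
have small M (z : unitization A) : 0 <= M ->
    (forall k, ubound (M * (1 - x k)) z) -> z = 0.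
  move=> M0 hz; apply: ubound_small => e e0.
  have [|k hk] := @x_lim (e / (M + 1)); first by rewrite divr_gt0// ltr_wpDl.
  apply: ubound_le (hz k); rewrite ltr_pdivlMr ?ltr_wpDl// in hk.
  by have := x01 k; nra.
have u_comm c : GRing.comm c w -> GRing.comm c u.
  move=> cw; have [M cM] := ubound_exists c; have M0 : 0 <= M by case: cM.
  apply/eqP; rewrite -subr_eq0; apply/eqP.
  apply: (@small (8 * M)) => [|k]; first by rewrite mulr_ge0.
  have -> : c * u - u * c = c * (u - v k) - (u - v k) * c.
    rewrite mulrBr mulrBl (v_comm k cw : c * v k = v k * c).
    by rewrite opprB addrA subrK.
  have -> : 8 * M * (1 - x k) = M * ((1 - x k) *+ 4) + (1 - x k) *+ 4 * M by ring.
  by apply: uboundB; exact: uboundM.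
have u_sa : ustar u = u.
  apply/eqP; rewrite -subr_eq0; apply/eqP; apply: (@small 8) => // k.
  have -> : ustar u - u = ustar (u - v k) - (u - v k).
    by rewrite ustarB v_sa opprB addrA subrK.
  have -> : 8 * (1 - x k) = (1 - x k) *+ 4 + (1 - x k) *+ 4 by ring.
  by apply: uboundB => //; exact: ubound_star.
have u1 : ubound 1 u.
  apply: ubound_closed => e e0.
  have [|k hk] := @x_lim (e / 4); first by rewrite divr_gt0.
  have -> : u = v k + (u - v k) by rewrite addrC subrK.
  apply: (@ubound_le _ _ (x k + (1 - x k) *+ 4)); last exact: uboundD.
  by have := x01 k; lra.
have uE : u = half *: (w + u * u).
  apply/eqP; rewrite -subr_eq0; apply/eqP; apply: (@small 8) => // k.
  (* Inserting [v k.+1 = half *: (w + v k * v k)] makes [w] cancel and leaves a difference of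
     commuting squares. *)
  have -> : u - half *: (w + u * u) =
      (u - v k.+1) + half *: ((v k - u) * (v k + u)).
    have cv : GRing.comm (v k) u.
      by apply: u_comm; apply: commr_sym; exact: v_comm.
    have -> : (v k - u) * (v k + u) = v k * v k - u * u.
      by rewrite mulrDr !mulrBl cv addrA subrK.
    rewrite vS -[RHS]addrA; congr (u + _); rewrite -!scalerN -scalerDr; congr (_ *: _).
    have aux (p q r : unitization A) : - (p + r) = - (p + q) + (q - r).
      by rewrite !opprD -[RHS]addrA addKr.
    exact: aux.
  apply: (@ubound_le _ _ ((1 - x k.+1) *+ 4 + 2^-1 * ((1 - x k) *+ 4 * (1 + 1)))).
    exact: half_sqr_rate.
  apply: uboundD => //; apply: uboundZr => //; apply: uboundM.
    by rewrite -(opprB u); exact: uboundN.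
  apply: uboundD => //; apply: ubound_le (v_bound k); by have /andP[] := x01 k.
exists (1 - u); split.
- by rewrite ustarB ustar1 u_sa.
- have u2 : u + u = w + u * u by rewrite {1 2}uE -scalerDr; exact: scale_half.
  rewrite mulrBl mul1r mulrBr mulr1 opprB addrA addrAC -(addrA 1 (- u)).
  by rewrite -opprD u2 opprD addrA addrNK /w subKr.
- by rewrite opprB addrC subrK.
- move=> c cy; apply: commrB; first exact: commr1.
  by apply: u_comm; apply: commrB => //; exact: commr1.
Qed.

End Sqrt.

(** * The positive cone *)

Section PositiveCone.
Context {R : realType} {A : cstarAlgType R}.
Implicit Types (x y z a b c d e f : unitization A) (s t M N : R).

Lemma urealD s t : ureal (s + t) = ureal s + ureal t :> unitization A.
Proof. by rewrite /ureal rmorphD scalerDl. Qed.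

Lemma mul_ureal t x : ureal t * x = t%:C *: x.
Proof. by rewrite -scalerAl mul1r. Qed.

Lemma uposD x y : upos x -> upos y -> upos (x + y).
Proof.
move=> [xs [s s0 xb]] [ys [t t0 yb]]; split; first by rewrite ustarD xs ys.
by exists (s + t); rewrite ?addr_ge0// urealD opprD addrACA; exact: uboundD.
Qed.

Lemma uposZ t x : 0 <= t -> upos x -> upos (t%:C *: x).
Proof.
move=> t0 [xs [s s0 xb]]; split; first by rewrite ustarZ conjC_real xs.
exists (t * s); rewrite ?mulr_ge0//.
by rewrite /ureal rmorphM -scalerA -scalerBr; exact: uboundZr.
Qed.

Lemma upos_subr t x : ustar x = x -> ubound t x -> upos (ureal t - x).
Proof.
move=> xs xt; split; first by rewrite ustarB ustar_real xs.
by exists t; [case: xt|rewrite subKr].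
Qed.

(** Divide by [t] to reach [usqrt_contraction], then multiply the root by [Num.sqrt t]. *)
Lemma upos_sqrt x : upos x -> exists b, [/\ ustar b = b, b * b = x, upos b &
  forall c, GRing.comm c x -> GRing.comm c b].
Proof.
(* Adding 1 makes the scaling factor invertible even when [t0 = 0]. *)
move=> [xs [t0 t00 xt0]]; pose t := t0 + 1; have tgt : 0 < t by rewrite ltr_wpDl.
have tC : t%:C != 0 :> R[i] by rewrite eq_complex /= gt_eqF.
have xt : ubound t (ureal t - x).
  rewrite urealD addrAC; apply: uboundD => //; exact: ubound_real.
have [||b [bs bb b1 bc]] := @usqrt_contraction R A ((t^-1)%:C *: x).
- by rewrite ustarZ conjC_real xs.
- have -> : 1 - (t^-1)%:C *: x = (t^-1)%:C *: (ureal t - x).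
    by rewrite scalerBr scalerA -rmorphM mulVf ?gt_eqF// scale1r.
  by rewrite -[X in ubound X](mulVf (lt0r_neq0 tgt)); apply: uboundZr;
    rewrite ?invr_ge0 ?ltW.
have s0 : 0 <= Num.sqrt t by exact: sqrtr_ge0.
exists ((Num.sqrt t)%:C *: b); split.
- by rewrite ustarZ conjC_real bs.
- rewrite -scalerAl -scalerAr scalerA -rmorphM -expr2 sqr_sqrtr ?(ltW tgt)// bb.
  by rewrite scalerA -rmorphM mulfV ?gt_eqF// scale1r.
- split; first by rewrite ustarZ conjC_real bs.
  exists (Num.sqrt t) => //; rewrite -scalerBr -[X in ubound X]mulr1.
  exact: uboundZr.
- move=> c cx; have /bc cb : GRing.comm c ((t^-1)%:C *: x).
    by rewrite /GRing.comm -scalerAr -scalerAl cx.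
  by rewrite /GRing.comm -scalerAr -scalerAl cb.
Qed.

(* [e + i d] is unitary. *)
Lemma ubound1_sqrD1 e d : ustar e = e -> ustar d = d -> GRing.comm e d ->
  e * e + d * d = 1 -> ubound 1 e.
Proof.
move=> es ds ed ed1; pose u := e + 'i *: d.
have us : ustar u = e - 'i *: d by rewrite ustarD ustarZ conjCi es ds scaleNr.
have u1 : ubound 1 u.
  apply: ubound_starM => //; rewrite expr1n us mulrBl !mulrDr.
  rewrite -!scalerAl -!scalerAr !scalerA -(expr2 'i) sqrCi scaleN1r ed.
  by rewrite opprD opprK addrA addrK ed1; exact: ubound1.
have := uboundD u1 (ubound_star u1); rewrite us /u => e2.
have h0 : (0 : R) <= 2^-1 by rewrite invr_ge0.
have := uboundZr h0 e2; rewrite addrACA subrr addr0 ?scale_half.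
by rewrite mulVf.
Qed.

(** Scale [b] to a contraction [e] and let [s] be the root of [1 - e * e]. Since
    [s * s + e * e = 1], [s] is a contraction too, so [1 - e * e = s * s] is bounded by 1. *)
Lemma upos_sqr b : ustar b = b -> upos (b * b).
Proof.
move=> bs; have [M0 bM0] := ubound_exists b.
pose M := M0 + 1; have M_gt0 : 0 < M by case: bM0 => ? _ _; rewrite ltr_wpDl.
have bM : ubound M b by apply: ubound_le bM0; rewrite lerDl.
pose e : unitization A := (M^-1)%:C *: b.
have es : ustar e = e by rewrite ustarZ conjC_real bs.
have e1 : ubound 1 e.
  rewrite -[X in ubound X](mulVf (lt0r_neq0 M_gt0)); apply: uboundZr => //.
  by rewrite invr_ge0 ltW.
have [||s [ss sq _ sc]] := @usqrt_contraction R A (1 - e * e).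
- by rewrite ustarB ustar1 ustarM es.
- by rewrite subKr -[X in ubound X]mulr1; exact: uboundM.
have s1 : ubound 1 s.
  apply: (@ubound1_sqrD1 s e) => //; last by rewrite sq subrK.
  apply/commr_sym/sc; apply: commrB; first exact: commr1.
  by apply: commrM; exact: commr_refl.
have -> : b * b = (M ^+ 2)%:C *: (e * e).
  rewrite -scalerAl -scalerAr !scalerA -!rmorphM expr2.
  by rewrite mulfK ?gt_eqF// mulfV ?gt_eqF// scale1r.
apply: uposZ; first exact: sqr_ge0.
split; first by rewrite ustarM es.
exists 1 => //; rewrite /ureal scale1r -sq -[X in ubound X]mulr1.
exact: uboundM.
Qed.

(** Divide by [N]: then [x / N = e * e], and [1 - x / N = d * d] because it is [1 - (x + y) / N]
    plus [y / N]. So [e * e + d * d = 1] makes [e] a contraction. The margin [eps] allows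
    [M = 0]. *)
Lemma upos_mono M x y : 0 <= M -> upos x -> upos y -> ubound M (x + y) -> ubound M x.
Proof.
move=> M0 xp yp xyM; apply: ubound_closed => eps eps0.
pose N := M + eps; have N0 : 0 < N by rewrite ltr_wpDl.
have NV : N * N^-1 = 1 by rewrite mulfV ?gt_eqF.
have V0 : 0 <= N^-1 by rewrite invr_ge0 ltW.
have xyN : ubound 1 ((N^-1)%:C *: (x + y)).
  rewrite -NV mulrC; apply: uboundZr => //; apply: ubound_le xyM.
  by rewrite lerDl ltW.
have xN := uposZ V0 xp; have yN := uposZ V0 yp.
have [d [ds dd _ dc]] : exists d, [/\ ustar d = d, d * d = 1 - (N^-1)%:C *: x, upos d &
    forall c, GRing.comm c (1 - (N^-1)%:C *: x) -> GRing.comm c d].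
  apply: upos_sqrt.
  have -> : 1 - (N^-1)%:C *: x = (ureal 1 - (N^-1)%:C *: (x + y)) + (N^-1)%:C *: y.
    by rewrite scalerDr opprD addrA addrNK /ureal scale1r.
  apply: uposD => //; apply: upos_subr => //.
  by case: xN yN => xs _ [ys _]; rewrite scalerDr ustarD xs ys.
have [e [es ee _ ec]] := upos_sqrt xN.
have e1 : ubound 1 e.
  apply: (@ubound1_sqrD1 e d) => //; last by rewrite ee dd addrC subrK.
  apply: dc; apply: commrB; first exact: commr1.
  by apply/commr_sym/ec/commr_refl.
have -> : x = N%:C *: (e * e) by rewrite ee scalerA -rmorphM NV scale1r.
rewrite -(mulr1 (M + eps)); apply: uboundZr; first exact: ltW.
by rewrite -(mulr1 1); exact: uboundM.
Qed.

(* [c^* c + c c^* = 2 (x^2 + y^2)] where [c = x + i y]. *)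
Lemma upos_starMD c : upos (ustar c * c + c * ustar c).
Proof.
pose x := c + ustar c; pose y := 'i *: (c - ustar c).
have xs : ustar x = x by rewrite ustarD ustarK addrC.
have ys : ustar y = y.
  by rewrite ustarZ conjCi ustarB ustarK scaleNr -scalerN opprB.
have -> : ustar c * c + c * ustar c = (2^-1)%:C *: (x * x + y * y).
  pose p := ustar c * c + c * ustar c; pose q := c * c + ustar c * ustar c.
  have -> : x * x = p + q.
    by rewrite mulrDl !mulrDr /p !addrA [RHS](ACl (3*2*1*4))%AC.
  have -> : y * y = p - q.
    rewrite -scalerAl -scalerAr scalerA -(expr2 'i) sqrCi scaleN1r.
    by rewrite mulrBl !mulrBr !opprB /p /q opprD !addrA [LHS](ACl (1*3*4*2))%AC.
  rewrite addrACA subrr addr0.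
  by rewrite scale_half.
apply: uposZ; first by rewrite invr_ge0.
by apply: uposD; exact: upos_sqr.
Qed.

Lemma mulr_star_eq0 c : ustar c * c = 0 -> c = 0.
Proof.
move=> cc0; apply: ubound0_eq0; apply: ubound_starM => //.
by rewrite cc0; apply/ubound_inP; rewrite rnorm0 expr0n.
Qed.

(* For [g = d f], both [g^* g = - f^4] and [g g^* = - (d d^* )^2] are negative,
   whereas [g^* g + g g^*] is positive. *)
Lemma mulr_starNsqr_eq0 d f : ustar f = f -> ustar d * d = - (f * f) -> d = 0.
Proof.
move=> fs df; pose f2 := f * f; pose q := d * ustar d; pose g := d * f.
have f2s : ustar f2 = f2 by rewrite ustarM fs.
have qs : ustar q = q by rewrite ustarM ustarK.
have g1 : ustar g * g = - (f2 * f2).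
  by rewrite ustarM fs -mulrA (mulrA (ustar d)) df !mulNr mulrN !mulrA.
have g2 : g * ustar g = - (q * q).
  rewrite ustarM fs -mulrA (mulrA f) -/f2 -(opprK f2) -df.
  by rewrite mulNr mulrN /q !mulrA.
have f20 : ubound 0 (f2 * f2).
  (* By [g1] and [g2], this positive element equals [- (f2 * f2)], so its sum with [f2 * f2]
     vanishes. *)
  apply: (@upos_mono _ _ (q * q + (ustar g * g + g * ustar g))) => //.
  - exact: upos_sqr.
  - by apply: uposD; [exact: upos_sqr|exact: upos_starMD].
  rewrite g1 g2 -opprD addrA subrr.
  by apply/ubound_inP; rewrite rnorm0.
have {}f20 : f2 = 0 by apply: mulr_star_eq0; rewrite f2s; exact: ubound0_eq0.
by apply: mulr_star_eq0; rewrite df -/f2 f20 oppr0.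
Qed.

Lemma upos_starM c : upos (ustar c * c).
Proof.
pose a := ustar c * c; have as_ : ustar a = a by rewrite ustarM ustarK.
have [r [rs rr rp rc]] := upos_sqrt (upos_sqr as_).
have [w [ws ww _ wc]] := upos_sqrt rp.
have ar : GRing.comm a r by apply: rc; apply: commrM; exact: commr_refl.
pose n := r - a.
have ns : ustar n = n by rewrite ustarB rs as_.
have nr : GRing.comm n r.
  by apply/commr_sym/commrB; [exact: commr_refl|exact: commr_sym].
(* This uses [r * r = a * a]. *)
have na : n * a = - (r * n) by rewrite mulrBl mulrBr -rr opprB.
have nw : GRing.comm n w := wc _ nr.
have wn0 : w * n = 0.
  have wns : ustar (w * n) = w * n by rewrite ustarM ws ns nw.
  (* The left side is [n * a * n = - (r * n * n)], and [r = w * w] with [w] commuting with [n]; here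
     [f] is [w * n]. *)
  have cn : ustar (c * n) * (c * n) = - (w * n * (w * n)).
    rewrite ustarM ns mulrA -(mulrA n) -/a na mulNr -ww -!mulrA.
    by congr (- (w * _)); rewrite !mulrA nw.
  have cn0 : c * n = 0 by exact: mulr_starNsqr_eq0 cn.
  by apply: mulr_star_eq0; apply: oppr_inj; rewrite wns -cn cn0 mulr0 oppr0.
have rn0 : r * n = 0 by rewrite -ww -mulrA wn0 mulr0.
have n0 : n = 0.
  (* Both [n * r = r * n] and [n * a = - (r * n)] vanish, hence so does [n * n]. *)
  apply: mulr_star_eq0; rewrite ns {2}/n mulrBr na rn0 oppr0 subr0 nr //.
by have /subr0_eq ra : r - a = 0 := n0; rewrite -/a -ra.
Qed.

End PositiveCone.

(** * The order on the C*-algebra itself *)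

Section Order.
Context {R : realType} {A : cstarAlgType R}.
Implicit Types (a b c h : A) (t M : R).

(* The unitization is used only to make sense of [t - a]: [apos a] means
   [0 <= a] in the C*-algebra [A]. *)
Definition apos a := upos (uin a).

Lemma uinD a b : uin (a + b) = uin a + uin b.
Proof. by congr pair; rewrite /= addr0. Qed.

Lemma uinZ (k : R[i]) a : uin (k *: a) = k *: uin a.
Proof. by congr pair; rewrite /= [_ *: _]mulr0. Qed.

Lemma uinM a b : uin (cmul a b) = uin a * uin b.
Proof. by congr pair; rewrite /= ?mulr0// !scale0r !add0r. Qed.

Lemma uin_star a : uin (cstar a) = ustar (uin a).
Proof. by rewrite /ustar /= conjC0. Qed.

Lemma aposD a b : apos a -> apos b -> apos (a + b).
Proof. by rewrite /apos uinD; exact: uposD. Qed.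

Lemma aposZ t a : 0 <= t -> apos a -> apos (t%:C *: a).
Proof. by rewrite /apos uinZ; exact: uposZ. Qed.

Lemma apos_cpositive a : cpositive a -> apos a.
Proof. by case=> b ->; rewrite /apos uinM uin_star; exact: upos_starM. Qed.

Lemma apos0 : apos 0.
Proof. by apply: apos_cpositive; exists 0; rewrite cmul0r. Qed.

Lemma apos_star a : apos a -> cstar a = a.
Proof. by case; rewrite -uin_star => -[]. Qed.

Lemma rnorm_apos_le a b : apos a -> apos b -> rnorm a <= rnorm (a + b).
Proof.
move=> ap bp; apply/ubound_inP; apply: upos_mono ap bp _; first exact: rnorm_ge0.
by rewrite -uinD; exact/ubound_inP.
Qed.

(** Writing [M - h = g * g] with [g] self-adjoint, the difference is [ustar (g * c) * (g * c)]. *)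
Lemma apos_conj M h c : apos h -> rnorm h <= M ->
  apos (M%:C *: cmul (cstar c) c - cmul (cstar c) (cmul h c)).
Proof.
move=> [hs _] hM; have M0 : 0 <= M by rewrite (le_trans (rnorm_ge0 h)).
have [|g [gs gg _ _]] := @upos_sqrt R A (ureal M - uin h).
  by apply: upos_subr => //; exact/ubound_inP.
rewrite /apos uinD -scaleN1r !uinZ !uinM scaleN1r uin_star.
have -> : M%:C *: (ustar (uin c) * uin c) - ustar (uin c) * (uin h * uin c) =
    ustar (g * uin c) * (g * uin c).
  rewrite ustarM gs -mulrA (mulrA g) gg mulrBl mul_ureal mulrBr.
  by rewrite scalerAr.
exact: upos_starM.
Qed.

End Order.

(** * Hahn-Banach and norming states *)

Section HahnBanach.
Context {R : realType} {V : lmodType R[i]}.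
Implicit Types (p q : V -> R) (x y h : V) (s t : R).

(** Only positive real scalars occur, and only as an inequality; applying it to [t^-1] as well gives
    the equality in [sublinearZ]. *)
Definition sublinear p := [/\ p 0 = 0, forall x y, p (x + y) <= p x + p y &
  forall t x, 0 < t -> p (t%:C *: x) <= t * p x].

Lemma sublinear_ge p x : sublinear p -> - p (- x) <= p x.
Proof. by move=> [p0 pD _]; have := pD x (- x); rewrite subrr p0; lra. Qed.

Lemma sublinearZ p t x : sublinear p -> 0 <= t -> p (t%:C *: x) = t * p x.
Proof.
move=> [p0 _ pZ]; rewrite le_eqVlt => /predU1P[<-|t0].
  by rewrite scale0r p0 mul0r.
apply/eqP; rewrite eq_le pZ//= mulrC -ler_pdivlMr//.
rewrite -{1}(scale1r x) -(rmorph1 (real_complex R)) -(mulVf (lt0r_neq0 t0)).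
by rewrite rmorphM -scalerA (le_trans (pZ _ _ _)) ?invr_gt0// mulrC.
Qed.

(** The largest candidate compatible with growth [p y] along [y]: [t = 0] puts it below [p], and
    [t = 1] puts its value at [- y] below [- p y]. The infimum is finite because [- p (- x)] is a
    lower bound. *)
Definition sublinear_shift p y : V -> R := fun x =>
  inf [set p (x + t%:C *: y) - t * p y | t in [set t | 0 <= t]].

Lemma sublinear_shift_le p y t x : sublinear p -> 0 <= t ->
  sublinear_shift p y x <= p (x + t%:C *: y) - t * p y.
Proof.
move=> sp t0; apply: ge_inf; last by exists t.
exists (- p (- x)) => _ [s /= s0 <-].
have [_ /(_ (x + s%:C *: y) (- x)) pD _] := sp.
move: pD; rewrite addrAC subrr add0r sublinearZ//; lra.
Qed.

Lemma sublinear_shift_ge p y x c :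
  (forall t, 0 <= t -> c <= p (x + t%:C *: y) - t * p y) ->
  c <= sublinear_shift p y x.
Proof.
move=> cp; apply: lb_le_inf.
  by exists (p (x + 0%:C *: y) - 0 * p y), 0 => /=.
by move=> _ [t /= t0 <-]; exact: cp.
Qed.

Lemma sublinear_shiftP p y : sublinear p -> sublinear (sublinear_shift p y).
Proof.
move=> sp; have [p0 pD pZ] := sp; split.
- apply/eqP; rewrite eq_le; apply/andP; split.
    have := @sublinear_shift_le p y 0 0 sp (lexx 0).
    by rewrite scale0r addr0 p0 mul0r subr0.
  by apply: sublinear_shift_ge => t t0; rewrite add0r sublinearZ// subrr.
- move=> x z; rewrite -lerBlDl; apply: sublinear_shift_ge => t t0.
  rewrite lerBlDl -lerBlDr; apply: sublinear_shift_ge => s s0.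
  have := sublinear_shift_le y (x + z) sp (addr_ge0 s0 t0).
  rewrite rmorphD scalerDl addrACA.
  have := pD (x + s%:C *: y) (z + t%:C *: y); lra.
- move=> t x t0; rewrite mulrC -ler_pdivrMr//; apply: sublinear_shift_ge => s s0.
  rewrite ler_pdivrMr//.
  have := sublinear_shift_le y (t%:C *: x) sp (mulr_ge0 (ltW t0) s0).
  rewrite rmorphM -scalerA -scalerDr (sublinearZ _ sp (ltW t0)); lra.
Qed.

(** Zorn's lemma for the reversed pointwise order; a nonempty chain is bounded by its pointwise
    infimum, an empty one by [p]. *)
Lemma sublinear_minimal p : sublinear p ->
  exists2 q, sublinear q /\ (forall x, q x <= p x) &
  forall r, sublinear r -> (forall x, r x <= q x) -> r = q.
Proof.
move=> sp; pose S := {q | sublinear q /\ forall x, q x <= p x}.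
have S_eq (u v : S) : sval u = sval v -> u = v.
  by case: u v => [u up] [v vp] /= uv; subst v; congr exist; exact: Prop_irrelevance.
pose r (u v : S) := `[< forall x, sval v x <= sval u x >].
have [||||[q [sq qp]] qmin] := @Zorn S r.
- by move=> u; apply/asboolP.
- move=> u v w /asboolP vu /asboolP uw; apply/asboolP => x.
  exact: le_trans (uw x) (vu x).
- move=> u v /asboolP uv /asboolP vu; apply: S_eq; apply/funext => x.
  by apply/eqP; rewrite eq_le uv vu.
- move=> C Ctot; have [[u0 Cu0]|C0] := pselect (exists u, C u); last first.
    by exists (exist _ p (conj sp (fun x => lexx _))) => u Cu; case: C0; exists u.
  pose m x := inf [set sval u x | u in C].
  have m_le u x : C u -> m x <= sval u x.
    move=> Cu; apply: ge_inf; last by exists u.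
    exists (- p (- x)) => _ [v Cv <-]; have [sv vp] := svalP v.
    by rewrite (le_trans _ (sublinear_ge x sv))// lerN2 vp.
  have m_ge c x : (forall u, C u -> c <= sval u x) -> c <= m x.
    move=> cu; apply: lb_le_inf; first by exists (sval u0 x), u0.
    by move=> _ [u Cu <-]; exact: cu.
  have sm : sublinear m.
    split.
    - apply/eqP; rewrite eq_le; apply/andP; split.
        by have := m_le _ 0 Cu0; have [[-> _ _] _] := svalP u0.
      by apply: m_ge => u _; have [[-> _ _] _] := svalP u.
    - move=> x y; rewrite -lerBlDl; apply: (m_ge) => u Cu.
      rewrite lerBlDl -lerBlDr; apply: m_ge => v Cv; rewrite lerBlDr.
      have [[_ uD _] _] := svalP u; have [[_ vD _] _] := svalP v.
      (* Of the two members of the chain, the smaller one serves both arguments. *)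
      have [/asboolP vu|/asboolP uv] := Ctot _ _ Cu Cv.
        by rewrite (le_trans (m_le _ _ Cv))// (le_trans (vD _ _))// lerD2l.
      by rewrite (le_trans (m_le _ _ Cu))// (le_trans (uD _ _))// lerD2r.
    - move=> t x t0; rewrite mulrC -ler_pdivrMr//; apply: m_ge => u Cu.
      rewrite ler_pdivrMr// mulrC (le_trans (m_le _ _ Cu))//.
      by have [[_ _ uZ] _] := svalP u; exact: uZ.
  have mp x : m x <= p x by rewrite (le_trans (m_le _ _ Cu0))//; have [_] := svalP u0.
  by exists (exist _ m (conj sm mp)) => u Cu; apply/asboolP => x; exact: m_le.
exists q => // l sl lq.
have lp x : l x <= p x by rewrite (le_trans (lq x)).
have /qmin/(congr1 sval) // : r (exist _ q (conj sq qp)) (exist _ l (conj sl lp)).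
by apply/asboolP.
Qed.

(* A minimal sublinear functional [q] is additive because it coincides with its
   shifts, i.e. [q x <= q (x + y) - q y]. *)
Lemma hahn_banach p h : sublinear p -> exists f : V -> R,
  [/\ forall x y, f (x + y) = f x + f y, forall t x, f (t%:C *: x) = t * f x,
      forall x, f x <= p x & f h = p h].
Proof.
(* Starting below the shift by [h] forces [f (- h) <= - p h], hence [p h <= f h]. *)
move=> sp; have [f [sf fp] fmin] := sublinear_minimal (sublinear_shiftP h sp).
have f_le x : f x <= p x.
  have := sublinear_shift_le h x sp (lexx 0).
  by rewrite scale0r addr0 mul0r subr0; exact: le_trans.
have fD x y : f (x + y) = f x + f y.
  have [_ fD _] := sf; apply/eqP; rewrite eq_le fD/=.
  have fE : sublinear_shift f y = f.
    apply: fmin; first exact: sublinear_shiftP.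
    move=> z; have := sublinear_shift_le y z sf (lexx 0).
    by rewrite scale0r addr0 mul0r subr0.
  have := sublinear_shift_le y x sf ler01; rewrite fE rmorph1 scale1r mul1r; lra.
have f0 : f 0 = 0 by have [] := sf.
have fN x : f (- x) = - f x by apply/eqP; rewrite -addr_eq0 -fD addNr f0.
exists f; split => //.
- move=> t x; have [t0|t0] := leP 0 t; first exact: sublinearZ.
  rewrite -[t]opprK rmorphN scaleNr fN sublinearZ ?mulNr// oppr_ge0.
  exact: ltW.
- apply/eqP; rewrite eq_le f_le/= -lerN2 -fN (le_trans (fp _))//.
  have := sublinear_shift_le h (- h) sp ler01.
  by rewrite rmorph1 scale1r addNr mul1r; have [-> _ _] := sp; rewrite sub0r.
Qed.

End HahnBanach.

(** * States norming a positive element *)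

Section NormingState.
Context {R : realType} {A : cstarAlgType R}.
Implicit Types (a b h k : A) (t : R).

(** For [a] positive [q (- a) <= 0], so real functionals dominated by [q] are positive; and
    [q h = rnorm h] for positive [h], because the norm is monotone. *)
Let q a := inf [set rnorm (a + k) | k in apos].

Let q_le a k : apos k -> q a <= rnorm (a + k).
Proof.
move=> kp; apply: ge_inf; last by exists k.
by exists 0 => _ [l _ <-]; exact: rnorm_ge0.
Qed.

Let q_ge a c : (forall k, apos k -> c <= rnorm (a + k)) -> c <= q a.
Proof.
move=> cq; apply: lb_le_inf; first by exists (rnorm (a + 0)), 0 => //; exact: apos0.
by move=> _ [l lp <-]; exact: cq.
Qed.

Let q_ge0 a : 0 <= q a.
Proof. by apply: q_ge => k _; exact: rnorm_ge0. Qed.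

Let q_sublinear : sublinear q.
Proof.
split.
- apply/eqP; rewrite eq_le q_ge0 andbT.
  by have := q_le 0 apos0; rewrite addr0 rnorm0.
- move=> a b; rewrite -lerBlDl; apply: q_ge => l lp.
  rewrite lerBlDl -lerBlDr; apply: q_ge => k kp; rewrite lerBlDr.
  rewrite (le_trans (q_le _ (aposD kp lp)))// addrACA.
  exact: ler_rnormD.
- move=> t a t0; rewrite mulrC -ler_pdivrMr//; apply: q_ge => k kp.
  rewrite ler_pdivrMr// (le_trans (q_le _ (aposZ (ltW t0) kp)))//.
  by rewrite -scalerDr (rnormZr _ (ltW t0)) mulrC.
Qed.

Lemma norming_state h : apos h -> exists tau : A -> R[i],
  [/\ forall a b, tau (a + b) = tau a + tau b,
      forall (k : R[i]) a, tau (k *: a) = k * tau a,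
      forall a, apos a -> 0 <= tau a, forall a, normc (tau a) <= rnorm a &
      tau h = (rnorm h)%:C].
Proof.
move=> hp; have [f [fD fZ fq fh]] := hahn_banach h q_sublinear.
have f_le a : f a <= rnorm a.
  by rewrite (le_trans (fq a))// (le_trans (q_le _ apos0))// addr0.
have fN a : f (- a) = - f a.
  by rewrite -scaleN1r -(rmorphN1 (real_complex R)) fZ mulN1r.
have f_ge0 a : apos a -> 0 <= f a.
  move=> ap; rewrite -oppr_le0 -fN (le_trans (fq _))//.
  by rewrite (le_trans (q_le _ ap))// addNr rnorm0.
have {}fh : f h = rnorm h.
  apply/eqP; rewrite eq_le f_le fh; apply: q_ge => k kp; exact: rnorm_apos_le.
(* Averaging over the involution makes [g ('i *: a)] vanish for self-adjoint [a], so that [tau] is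
   real there. *)
pose g a := 2^-1 * (f a + f (cstar a)).
have gD a b : g (a + b) = g a + g b by rewrite /g cstarD !fD; lra.
have gZ t a : g (t%:C *: a) = t * g a by rewrite /g cstarZ conjC_real !fZ; lra.
have gN a : g (- a) = - g a by rewrite /g cstarN !fN; lra.
have g_le a : g a <= rnorm a.
  by rewrite /g; have := f_le a; have := f_le (cstar a); rewrite rnorm_cstar; lra.
have gi a : g ('i *: ('i *: a)) = - g a.
  by rewrite scalerA -expr2 sqrCi scaleN1r gN.
(* The complex linear functional with real part [g]. *)
pose tau a : R[i] := (g a -i* g ('i *: a))%C.
have tauD a b : tau (a + b) = tau a + tau b.
  by rewrite /tau scalerDr !gD opprD.
have tauZ (k : R[i]) a : tau (k *: a) = k * tau a.
  rewrite {1}[k]complexE complexiE /tau scalerDl -!scalerA scalerDr gD.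
  have iC t b : 'i *: (t%:C *: b) = t%:C *: ('i *: b).
    by rewrite !scalerA mulrC.
  rewrite !iC gD !gZ gi; case: (k) => x y /=; simpc.
  by congr Complex; lra.
have tau_real a : apos a -> tau a = (f a)%:C.
  move=> ap; rewrite /tau /g cstarZ conjCi scaleNr (apos_star ap) fN subrr mulr0 oppr0.
  by congr Complex; lra.
exists tau; split=> //.
- by move=> a ap; rewrite tau_real// ler0c f_ge0.
- move=> a; have [->|c0] := eqVneq (normc (tau a)) 0; first exact: rnorm_ge0.
  have cgt : 0 < normc (tau a) by rewrite lt_def c0 normc_ge0.
  rewrite -(ler_pM2l cgt).
  (* Multiplying [a] by the conjugate of [tau a] makes the value of [tau] real, hence equal to a
     value of [g], which the norm dominates. *)
  have -> : normc (tau a) * normc (tau a) = g ((tau a)^* *: a).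
    have : tau ((tau a)^* *: a) = (normc (tau a) ^+ 2)%:C.
      by rewrite tauZ mulrC -normCK rmorphXn.
    by case.
  rewrite (le_trans (g_le _))// rnormZ.
  have -> // : normc (tau a)^* = normc (tau a) by apply: complexI; exact: norm_conjC.
- by rewrite tau_real// fh.
Qed.

End NormingState.

(** * Hilbert modules *)

Section HilbertModule.
Context {R : realType} {A : cstarAlgType R} {V : hilbertModType A}.
Implicit Types (a b c : A) (x y z : V) (k : R[i]) (t M : R).

Lemma ract0l a : ract (0 : V) a = 0.
Proof. by have := ractZl 0 (0 : V) a; rewrite !scale0r. Qed.

Lemma inner0r x : inner x (0 : V) = 0.
Proof. by have := innerZr 0 x (0 : V); rewrite !scale0r. Qed.

Lemma inner0l x : inner (0 : V) x = 0.
Proof. by rewrite -cstar_inner inner0r cstar0. Qed.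

Lemma innerDl x y z : inner (x + y) z = inner x z + inner y z.
Proof. by rewrite -cstar_inner innerDr cstarD !cstar_inner. Qed.

Lemma innerZl k x y : inner (k *: x) y = k^* *: inner x y.
Proof. by rewrite -cstar_inner innerZr cstarZ cstar_inner. Qed.

Lemma innerNl x y : inner (- x) y = - inner x y.
Proof. by rewrite -scaleN1r innerZl rmorphN1 scaleN1r. Qed.

Lemma inner_ractl x y a : inner (ract x a) y = cmul (cstar a) (inner x y).
Proof. by rewrite -cstar_inner inner_ract cstarM cstar_inner. Qed.

Lemma rnorm_inner x : rnorm (inner x x) = rnorm x ^+ 2.
Proof. by apply: complexI; rewrite rmorphXn /= -!rnormE normr_inner. Qed.

Lemma apos_inner x : apos (inner x x).
Proof. exact/apos_cpositive/inner_positive. Qed.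

Lemma inner_ext x y : (forall z, inner x z = inner y z) -> x = y.
Proof.
move=> xy; apply/eqP; rewrite -subr_eq0; apply/eqP/inner_eq0.
by rewrite innerDl innerNl xy subrr.
Qed.

(** The square of the left side is the norm of [h^3]. It is at most [rnorm h ^+ 3], and at least
    that because [rnorm h ^+ 4], the norm of [h^4], is at most [rnorm h] times the norm of [h^3]. *)
Lemma rnorm_sqr_ract_inner x :
  rnorm (ract x (inner x x)) = rnorm x ^+ 3.
Proof.
set h := inner x x; have hE : rnorm h = rnorm x ^+ 2 by exact: rnorm_inner.
have hs : cstar h = h by apply/apos_star/apos_inner.
have h3 : rnorm (ract x h) ^+ 2 = rnorm (cmul h (cmul h h)).
  by rewrite -rnorm_inner inner_ractl inner_ract hs -/h.
have h2 : rnorm (cmul h h) = rnorm h ^+ 2 by rewrite -rnorm_cstarM hs.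
apply/eqP; rewrite -(@eqrXn2 _ 2)// ?exprn_ge0 ?rnorm_ge0// h3 -exprM.
rewrite (exprM _ 2 3) -hE eq_le; apply/andP; split.
  rewrite (le_trans (rnorm_cmul _ _))// h2 exprS.
  by rewrite ler_wpM2l ?rnorm_ge0.
have [->|h0] := eqVneq (rnorm h) 0; first by rewrite expr0n rnorm_ge0.
have hgt : 0 < rnorm h by rewrite lt_def h0 rnorm_ge0.
rewrite -(ler_pM2l hgt) -exprS (exprM _ 2 2) -h2 -rnorm_cstarM cstarM hs.
by rewrite -cmulA rnorm_cmul.
Qed.

End HilbertModule.

(** * The direct sum of [A] and [V], and the Cauchy-Schwarz inequality *)

Section DirectSum.
Context {R : realType} {A : cstarAlgType R} {V : hilbertModType A}.
Implicit Types (u v w : A * V) (a b c : A) (x y z : V) (k : R[i]) (t M : R).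

Lemma dsum_innerDr u v w : dsum_inner u (v + w) = dsum_inner u v + dsum_inner u w.
Proof. by rewrite /dsum_inner /= cmulDr innerDr addrACA. Qed.

Lemma dsum_innerZr u k v : dsum_inner u (k *: v) = k *: dsum_inner u v.
Proof. by rewrite /dsum_inner /= cmulZr innerZr scalerDr. Qed.

Lemma cstar_dsum_inner u v : cstar (dsum_inner u v) = dsum_inner v u.
Proof. by rewrite /dsum_inner cstarD cstarM cstarK cstar_inner. Qed.

Lemma dsum_innerDl u v w : dsum_inner (u + v) w = dsum_inner u w + dsum_inner v w.
Proof. by rewrite -cstar_dsum_inner dsum_innerDr cstarD !cstar_dsum_inner. Qed.

Lemma dsum_innerZl u k v : dsum_inner (k *: u) v = k^* *: dsum_inner u v.
Proof. by rewrite -cstar_dsum_inner dsum_innerZr cstarZ cstar_dsum_inner. Qed.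

Lemma dsum_inner_ract u v a :
  dsum_inner u (cmul v.1 a, ract v.2 a) = cmul (dsum_inner u v) a.
Proof. by rewrite /dsum_inner /= cmulA inner_ract cmulDl. Qed.

Lemma apos_dsum_inner u : apos (dsum_inner u u).
Proof.
by apply: aposD; [apply: apos_cpositive; exists u.1|exact: apos_inner].
Qed.

Lemma dsum_norm_ge0 u : 0 <= dsum_norm u. Proof. exact: sqrtr_ge0. Qed.

Lemma sqr_dsum_norm u : dsum_norm u ^+ 2 = rnorm (dsum_inner u u).
Proof. by rewrite sqr_sqrtr// rnorm_ge0. Qed.

Lemma dsum_norm_le u M : 0 <= M -> rnorm (dsum_inner u u) <= M ^+ 2 -> dsum_norm u <= M.
Proof.
by move=> M0; rewrite -sqr_dsum_norm ler_pXn2r// nnegrE dsum_norm_ge0.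
Qed.

Lemma dsum_normZr t u : 0 <= t -> dsum_norm (t%:C *: u) = t * dsum_norm u.
Proof.
move=> t0; rewrite /dsum_norm dsum_innerZl dsum_innerZr scalerA conjC_real.
by rewrite -rmorphM rnormZr ?mulr_ge0// sqrtrM ?mulr_ge0// -expr2 sqrtr_sqr ger0_norm.
Qed.

Lemma dsum_norm_fst a : dsum_norm (a, 0 : V) = rnorm a.
Proof.
rewrite /dsum_norm /dsum_inner /= inner0r addr0 rnorm_cstarM sqrtr_sqr.
by rewrite ger0_norm ?rnorm_ge0.
Qed.

Lemma dsum_norm_snd x : dsum_norm (0 : A, x) = rnorm x.
Proof.
rewrite /dsum_norm /dsum_inner /= cmul0r add0r rnorm_inner sqrtr_sqr.
by rewrite ger0_norm ?rnorm_ge0.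
Qed.

Lemma rnorm_fst_le u : rnorm u.1 <= dsum_norm u.
Proof.
rewrite -(@ler_pXn2r _ 2)// ?nnegrE ?rnorm_ge0 ?dsum_norm_ge0// sqr_dsum_norm.
rewrite -rnorm_cstarM; apply: rnorm_apos_le; last exact: apos_inner.
by apply: apos_cpositive; exists u.1.
Qed.

Lemma rnorm_snd_le u : rnorm u.2 <= dsum_norm u.
Proof.
rewrite -(@ler_pXn2r _ 2)// ?nnegrE ?rnorm_ge0 ?dsum_norm_ge0// sqr_dsum_norm.
rewrite -rnorm_inner /dsum_inner addrC; apply: rnorm_apos_le; first exact: apos_inner.
by apply: apos_cpositive; exists u.1.
Qed.

Lemma dsum_norm0_eq0 u : dsum_norm u = 0 -> u = 0.
Proof.
case: u => a x u0; have := rnorm_fst_le (a, x); have := rnorm_snd_le (a, x).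
rewrite u0 /= => x0 a0; congr pair; apply: rnorm0_eq0; apply/eqP; rewrite eq_le.
  by rewrite a0 rnorm_ge0.
by rewrite x0 rnorm_ge0.
Qed.

(* Expand [0 <= <u c - M v, u c - M v>] where [c = <u, v>]. *)
Lemma dsum_cauchy_schwarz_apos M u v : 0 < M -> rnorm (dsum_inner u u) <= M ->
  apos (M%:C *: dsum_inner v v - cmul (cstar (dsum_inner u v)) (dsum_inner u v)).
Proof.
move=> M0 uM; set c := dsum_inner u v; set hv := dsum_inner v v.
pose w : A * V := (cmul u.1 c, ract u.2 c) - M%:C *: v.
have cvu : cmul (dsum_inner v u) c = cmul (cstar c) c by rewrite cstar_dsum_inner.
have wE : dsum_inner w w = cmul (cstar c) (cmul (dsum_inner u u) c)
    - M%:C *: cmul (cstar c) c - M%:C *: cmul (cstar c) c + (M * M)%:C *: hv.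
  have uc : dsum_inner (cmul u.1 c, ract u.2 c) v = cmul (cstar c) c.
    by rewrite -cstar_dsum_inner dsum_inner_ract cvu cstarM cstarK.
  have ucuc : dsum_inner (cmul u.1 c, ract u.2 c) (cmul u.1 c, ract u.2 c) =
      cmul (cstar c) (cmul (dsum_inner u u) c).
    rewrite dsum_inner_ract -cstar_dsum_inner dsum_inner_ract cstarM.
    by rewrite cstar_dsum_inner cmulA.
  rewrite /w -scaleNr -rmorphN.
  rewrite !(dsum_innerDl, dsum_innerDr, dsum_innerZl, dsum_innerZr).
  rewrite ucuc uc dsum_inner_ract cvu conjC_real.
  by rewrite scalerA -rmorphM mulrNN !rmorphN !scaleNr addrA.
(* The added positive term, from [apos_conj], removes [dsum_inner u u]; what remains is [M] times
   the claimed element. *)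
have : apos ((M^-1)%:C *: (dsum_inner w w +
    (M%:C *: cmul (cstar c) c - cmul (cstar c) (cmul (dsum_inner u u) c)))).
  apply: aposZ; first by rewrite invr_ge0 ltW.
  apply: aposD; first exact: apos_dsum_inner.
  exact: apos_conj (apos_dsum_inner u) uM.
congr apos; rewrite wE.
set p := cmul (cstar c) (cmul _ c); set q := _ *: cmul _ c.
rewrite [X in _ *: X](_ : _ = M%:C *: (M%:C *: hv - cmul (cstar c) c)).
  by rewrite scalerA -rmorphM mulVf ?gt_eqF// scale1r.
have aux (s1 s2 s3 : A) : s1 - s2 - s2 + s3 + (s2 - s1) = s3 - s2.
  by rewrite !addrA [LHS](ACl ((1*6)*(2*5)*3*4))%AC /= subrr addNr !add0r addrC.
by rewrite scalerBr scalerA -rmorphM -/q aux.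
Qed.

Lemma dsum_cauchy_schwarz u v : rnorm (dsum_inner u v) <= dsum_norm u * dsum_norm v.
Proof.
(* The constant [M] will be [rnorm (dsum_inner u u)], which has to be positive. *)
have [/dsum_norm0_eq0 ->|u0] := eqVneq (dsum_norm u) 0.
  rewrite (_ : dsum_inner 0 v = 0) ?rnorm0 ?mulr_ge0 ?dsum_norm_ge0//.
  by rewrite /dsum_inner /= cstar0 cmul0l inner0l addr0.
have ugt : 0 < rnorm (dsum_inner u u).
  by rewrite -sqr_dsum_norm exprn_gt0// lt_def u0 dsum_norm_ge0.
rewrite -(@ler_pXn2r _ 2)// ?nnegrE ?rnorm_ge0 ?mulr_ge0 ?dsum_norm_ge0//.
rewrite exprMn !sqr_dsum_norm -rnorm_cstarM -(rnormZr _ (ltW ugt)).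
have cs := dsum_cauchy_schwarz_apos v ugt (lexx _).
rewrite -[X in _ <= rnorm X](subrK (cmul (cstar (dsum_inner u v)) (dsum_inner u v))).
rewrite [X in _ <= rnorm X]addrC; apply: rnorm_apos_le => //.
by apply: apos_cpositive; exists (dsum_inner u v).
Qed.

Lemma ler_dsum_normD u v : dsum_norm (u + v) <= dsum_norm u + dsum_norm v.
Proof.
apply: dsum_norm_le; first by rewrite addr_ge0 ?dsum_norm_ge0.
rewrite dsum_innerDl !dsum_innerDr.
have := ler_rnormD (dsum_inner u u + dsum_inner u v) (dsum_inner v u + dsum_inner v v).
have := ler_rnormD (dsum_inner u u) (dsum_inner u v).
have := ler_rnormD (dsum_inner v u) (dsum_inner v v).
have := dsum_cauchy_schwarz u v; have := dsum_cauchy_schwarz v u.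
rewrite -!sqr_dsum_norm; nra.
Qed.

Lemma cauchy_schwarz x y : rnorm (inner x y) <= rnorm x * rnorm y.
Proof.
have := dsum_cauchy_schwarz (0, x) (0, y).
by rewrite !dsum_norm_snd /dsum_inner /= cmul0r add0r.
Qed.

Lemma rnorm_ract x a : rnorm (ract x a) <= rnorm x * rnorm a.
Proof.
rewrite -(@ler_pXn2r _ 2)// ?nnegrE ?mulr_ge0 ?rnorm_ge0//.
rewrite -rnorm_inner inner_ractl inner_ract (le_trans (rnorm_cmul _ _))//.
rewrite rnorm_cstar exprMn -rnorm_inner mulrC expr2 mulrA ler_wpM2r ?rnorm_ge0//.
exact: rnorm_cmul.
Qed.

End DirectSum.

(** * The linking algebra *)

Section Operators.
Context {R : realType} {A : cstarAlgType R} {V : hilbertModType A}.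
Implicit Types (F G H : A * V -> A * V) (T S : V -> V) (u v w : A * V).
Implicit Types (a b c : A) (x y z : V) (t M : R).

Lemma op_norm_le F M : 0 <= M -> (forall w, dsum_norm (F w) <= M * dsum_norm w) ->
  op_norm F <= M.
Proof.
move=> M0 FM; apply: ge_sup.
  by exists (dsum_norm (F 0)), 0 => //=; rewrite dsum_norm_fst rnorm0.
by move=> _ [w /= w1 <-]; rewrite (le_trans (FM w))// ler_piMr.
Qed.

Lemma op_norm_ge F M w : (forall w, dsum_norm (F w) <= M * dsum_norm w) -> 0 <= M ->
  dsum_norm w <= 1 -> dsum_norm (F w) <= op_norm F.
Proof.
move=> FM M0 w1; apply: ub_le_sup; last by exists w.
by exists M => _ [v /= v1 <-]; rewrite (le_trans (FM v))// ler_piMr.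
Qed.

Lemma op_norm_bound F M w : (forall w, dsum_norm (F w) <= M * dsum_norm w) -> 0 <= M ->
  (forall t u, F (t%:C *: u) = t%:C *: F u) ->
  dsum_norm (F w) <= op_norm F * dsum_norm w.
Proof.
move=> FM M0 FZ; have [w0|w0] := eqVneq (dsum_norm w) 0.
  by have := FM w; rewrite w0 !mulr0.
have wgt : 0 < dsum_norm w by rewrite lt_def w0 dsum_norm_ge0.
have V0 : 0 <= (dsum_norm w)^-1 by rewrite invr_ge0 ltW.
rewrite -ler_pdivrMr// mulrC -dsum_normZr// -FZ; apply: op_norm_ge FM M0 _.
by rewrite dsum_normZr// mulVf.
Qed.

(** Operators are arbitrary functions here; homogeneity comes from the adjoint. *)
Lemma adjointableZ T t x : adjointable T -> T (t%:C *: x) = t%:C *: T x.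
Proof.
by move=> [S TS]; apply: inner_ext => z; rewrite innerZl !TS innerZl.
Qed.

Lemma theta_span_bounded S : theta_span S ->
  exists2 M, 0 <= M & forall z, rnorm (S z) <= M * rnorm z.
Proof.
case=> n [c [x [y ->]]].
exists (\sum_(i < n) normc (c i) * (rnorm (x i) * rnorm (y i))).
  by apply: sumr_ge0 => i _; rewrite !mulr_ge0 ?normc_ge0 ?rnorm_ge0.
move=> z; rewrite fct_sumE mulr_suml.
elim/big_ind2: _ => [|u1 r1 u2 r2 h1 h2|i _]; first by rewrite rnorm0.
  by rewrite (le_trans (ler_rnormD _ _))// lerD.
rewrite rnormZ -mulrA ler_wpM2l ?normc_ge0// (le_trans (rnorm_ract _ _))//.
by rewrite -mulrA ler_wpM2l ?rnorm_ge0// cauchy_schwarz.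
Qed.

(** [T] is within distance 1 of a finite-rank map, which is bounded. *)
Lemma compact_op_bounded T : compact_op T ->
  exists2 M, 0 <= M & forall z, rnorm (T z) <= M * rnorm z.
Proof.
case=> _ /(_ 1 ltr01)[S /theta_span_bounded[M M0 SM] TS].
exists (1 + M); first by rewrite addr_ge0.
move=> z; rewrite -(subrK (S z) (T z)) (le_trans (ler_rnormD _ _))// mulrDl.
exact: lerD.
Qed.

Lemma compact_op0 : compact_op (0 : V -> V).
Proof.
split; first by exists 0 => x y; rewrite inner0l inner0r.
move=> e e0; exists 0; last by move=> z; rewrite subr0 rnorm0 mulr_ge0 ?rnorm_ge0 ?ltW.
exists 0%N, (fun=> 0), (fun=> 0), (fun=> 0); by rewrite big_ord0.
Qed.

Lemma T_0 : T_ (0 : A) = 0.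
Proof. by apply/funext => a; rewrite /T_ cmul0l. Qed.

Lemma l_0 : l_ (0 : V) = 0.
Proof. by apply/funext => a; rewrite /l_ inner0l. Qed.

Lemma r_0 : r_ (0 : V) = 0.
Proof. by apply/funext => a; rewrite /r_ ract0l. Qed.

Lemma linking_antidiag x y : linking (mx2 0 (l_ y) (r_ x) 0).
Proof. by exists 0, x, y, 0; split; [exact: compact_op0|rewrite T_0]. Qed.

Lemma linking_corner x : linking (mx2 0 0 (r_ x) 0).
Proof. by rewrite -l_0; exact: linking_antidiag. Qed.

Lemma linkingZ F t u : linking F -> F (t%:C *: u) = t%:C *: F u.
Proof.
case=> [a [x [y [T [[Tadj _] ->]]]]]; rewrite /mx2 /T_ /l_ /r_ /=.
by rewrite cmulZr innerZr ractZr adjointableZ// -!scalerDr.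
Qed.

(** A crude sum of bounds on the entries; it makes the supremum in [op_norm] one of a bounded
    set. *)
Lemma linking_bounded F : linking F ->
  exists2 M, 0 <= M & forall w, dsum_norm (F w) <= M * dsum_norm w.
Proof.
case=> [a [x [y [T [/compact_op_bounded[M M0 TM] ->]]]]].
exists (rnorm a + rnorm y + (rnorm x + M)).
  by rewrite !addr_ge0 ?rnorm_ge0.
move=> w; rewrite /mx2 /T_ /l_ /r_.
set p := _ + _; set q := _ + _.
have -> : (p, q) = (p, 0) + (0, q) by congr pair; rewrite /= ?addr0 ?add0r.
rewrite (le_trans (ler_dsum_normD _ _))// dsum_norm_fst dsum_norm_snd mulrDl.
have w1 := rnorm_fst_le w; have w2 := rnorm_snd_le w.
rewrite lerD// (le_trans (ler_rnormD _ _))// mulrDl lerD//.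
- by rewrite (le_trans (rnorm_cmul _ _))// ler_wpM2l ?rnorm_ge0.
- by rewrite (le_trans (cauchy_schwarz _ _))// ler_wpM2l ?rnorm_ge0.
- by rewrite (le_trans (rnorm_ract _ _))// ler_wpM2l ?rnorm_ge0.
- by rewrite (le_trans (TM _))// ler_wpM2l.
Qed.

Lemma linking_op_norm F w : linking F -> dsum_norm (F w) <= op_norm F * dsum_norm w.
Proof.
move=> LF; have [M M0 FM] := linking_bounded LF.
by apply: op_norm_bound FM M0 _ => t u; exact: linkingZ.
Qed.

Lemma corner_bound x w : dsum_norm (mx2 0 0 (r_ x) 0 w) <= rnorm x * dsum_norm w.
Proof.
rewrite [mx2 _ _ _ _ _](_ : _ = (0, ract x w.1)); last first.
  by congr pair; rewrite /= ?addr0.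
rewrite dsum_norm_snd (le_trans (rnorm_ract _ _))// ler_wpM2l ?rnorm_ge0//.
exact: rnorm_fst_le.
Qed.

Lemma dsum_norm_opp_fst (a : A) x : dsum_norm (- a, x) = dsum_norm (a, x).
Proof. by rewrite /dsum_norm /dsum_inner /= cstarN cmulNl cmulNr opprK. Qed.

(** The gap between the two squared inner products is a sum of two positive elements: [apos_conj]
    handles [w.1], Cauchy-Schwarz handles [w.2]. *)
Lemma antidiag_bound x w :
  dsum_norm (inner x w.2, ract x w.1) <= rnorm x * dsum_norm w.
Proof.
have [/rnorm0_eq0 ->|x0] := eqVneq (rnorm x) 0.
  by rewrite inner0l ract0l dsum_norm_fst !rnorm0 mul0r.
have M0 : 0 < rnorm x ^+ 2 by rewrite exprn_gt0// lt_def x0 rnorm_ge0.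
apply: dsum_norm_le; first by rewrite mulr_ge0 ?rnorm_ge0 ?dsum_norm_ge0.
rewrite exprMn sqr_dsum_norm -(rnormZr _ (ltW M0)).
have xM : rnorm (inner x x) <= rnorm x ^+ 2 by rewrite rnorm_inner.
have h1 := apos_conj w.1 (apos_inner x) xM.
have h2 : apos ((rnorm x ^+ 2)%:C *: inner w.2 w.2
    - cmul (cstar (inner x w.2)) (inner x w.2)).
  have := @dsum_cauchy_schwarz_apos _ _ V (rnorm x ^+ 2) (0, x) (0, w.2) M0.
  by rewrite /dsum_inner /= !cmul0r !add0r; exact.
have -> : (rnorm x ^+ 2)%:C *: dsum_inner w w =
    dsum_inner (inner x w.2, ract x w.1) (inner x w.2, ract x w.1) +
    (((rnorm x ^+ 2)%:C *: cmul (cstar w.1) w.1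
        - cmul (cstar w.1) (cmul (inner x x) w.1)) +
     ((rnorm x ^+ 2)%:C *: inner w.2 w.2
        - cmul (cstar (inner x w.2)) (inner x w.2))).
  rewrite /dsum_inner /= inner_ractl inner_ract scalerDr.
  have aux (p q r s : A) : p + q = (r + s) + ((p - s) + (q - r)).
    by rewrite (addrC r) addrACA (addrC s) (addrC r) !subrK.
  exact: aux.
by apply: rnorm_apos_le; [exact: apos_dsum_inner|exact: aposD].
Qed.

(** The hypothesis only fixes norms of values, so that both signs of the corner [l_ x] are
    covered. *)
Lemma op_norm_antidiag F x :
  (forall w, dsum_norm (F w) = dsum_norm (inner x w.2, ract x w.1)) ->
  op_norm F = rnorm x.
Proof.
move=> FE; have Fx w : dsum_norm (F w) <= rnorm x * dsum_norm w.
  by rewrite FE antidiag_bound.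
apply/eqP; rewrite eq_le op_norm_le ?rnorm_ge0//=.
have [x0|x0] := eqVneq (rnorm x) 0.
  rewrite {1}x0 (le_trans (dsum_norm_ge0 (F 0)))//.
  by apply: op_norm_ge Fx _ _; rewrite ?rnorm_ge0// dsum_norm_fst rnorm0.
have x2 : 0 < rnorm x ^+ 2 by rewrite exprn_gt0// lt_def x0 rnorm_ge0.
have V0 : 0 <= (rnorm x ^+ 2)^-1 by rewrite invr_ge0 ltW.
(* A unit vector, by [rnorm_inner]; its image has norm [rnorm x ^+ 3 / rnorm x ^+ 2]. *)
pose w : A * V := (((rnorm x ^+ 2)^-1)%:C *: inner x x, 0).
have -> : rnorm x = dsum_norm (F w).
  rewrite FE /= inner0r dsum_norm_snd ractZr rnormZr// rnorm_sqr_ract_inner.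
  by rewrite (exprSr _ 2) mulrA mulVf ?gt_eqF// mul1r.
apply: op_norm_ge Fx _ _; rewrite ?rnorm_ge0// dsum_norm_fst rnormZr//.
by rewrite rnorm_inner mulVf ?gt_eqF.
Qed.

Lemma op_norm_antidiagD x : op_norm (mx2 0 (l_ x) (r_ x) 0) = rnorm x.
Proof.
apply: op_norm_antidiag => w; congr (dsum_norm _).
by congr pair; rewrite /= ?add0r ?addr0.
Qed.

Lemma op_norm_antidiagN x : op_norm (mx2 0 (- l_ x) (r_ x) 0) = rnorm x.
Proof.
apply: op_norm_antidiag => w; rewrite -dsum_norm_opp_fst; congr (dsum_norm _).
by congr pair; rewrite /= ?add0r ?addr0.
Qed.

(* The vector state of [u = (<y, y>, y <y, y>)], composed with a state of [A]
   norming [<y, y>^3]. *)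
Lemma corner_state y : rnorm y = 1 -> exists2 phi, states phi &
  forall t, phi (mx2 0 0 (r_ (t%:C *: y)) 0) = (t / 2)%:C.
Proof.
move=> y1; set h := inner y y; pose yh := ract y h; pose u : A * V := (h, yh).
have hs : cstar h = h by exact/apos_star/apos_inner.
have h1 : rnorm h = 1 by rewrite rnorm_inner y1 expr1n.
have yh1 : rnorm yh = 1 by rewrite rnorm_sqr_ract_inner y1 expr1n.
have [tau [tauD tauZ tau_ge0 tau_le tauh]] := norming_state (apos_inner yh).
rewrite rnorm_inner yh1 expr1n in tauh.
have yhE : cmul h (cmul h h) = inner yh yh by rewrite inner_ractl inner_ract hs.
pose phi F : R[i] := (2^-1)%:C * tau (dsum_inner u (F u)).
have half0 : (0 : R) <= 2^-1 by rewrite invr_ge0.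
(* The factor [2^-1] in [phi] compensates this 2. *)
have u2 : dsum_norm u ^+ 2 <= 2.
  rewrite sqr_dsum_norm (le_trans (ler_rnormD _ _))//=.
  by rewrite rnorm_cstarM h1 rnorm_inner yh1 !expr1n.
have phi_le F : linking F -> op_norm F <= 1 -> normc (phi F) <= 1.
  move=> LF F1; rewrite normcM ger0_normc// mulrC ler_pdivrMr// mul1r.
  rewrite (le_trans (tau_le _))// (le_trans (dsum_cauchy_schwarz _ _))//.
  rewrite (le_trans _ u2)// expr2 ler_wpM2l ?dsum_norm_ge0//.
  by rewrite (le_trans (linking_op_norm u LF))// ler_piMl ?dsum_norm_ge0.
(* The norm of [phi] is attained at this matrix of norm 1: it sends [u] to [(cmul h h, yh)], and
   both components contribute [h^3], where [tau] is 1. *)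
have phiF0 : phi (mx2 0 (l_ y) (r_ y) 0) = 1.
  rewrite /phi /dsum_inner /= add0r addr0 hs [l_ y yh]inner_ract -/h yhE.
  by rewrite [r_ y h](_ : _ = yh)// tauD tauh -rmorphD -rmorphM mulVf.
exists phi; last first.
  move=> t; rewrite /phi /dsum_inner /= !addr0 cmul0r add0r.
  rewrite [r_ _ h](_ : _ = t%:C *: yh); last by rewrite /r_ ractZl.
  by rewrite innerZr tauZ tauh -!rmorphM mulr1 mulrC.
split.
- move=> k F G _ _; rewrite /phi [(k *: F + G) u](_ : _ = k *: F u + G u)//.
  by rewrite dsum_innerDr dsum_innerZr tauD tauZ mulrDr mulrCA.
- move=> F [G [H [_ _ GH ->]]]; rewrite /phi /= -GH mulr_ge0 ?ler0c//.
  exact/tau_ge0/apos_dsum_inner.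
apply/eqP; rewrite eq_le; apply/andP; split.
  apply: ge_sup; last by move=> _ [F [/= LF F1] <-]; exact: phi_le.
  by exists (complex.Re `|phi (mx2 0 (l_ y) (r_ y) 0)|), (mx2 0 (l_ y) (r_ y) 0) => //=;
    split; [exact: linking_antidiag|rewrite op_norm_antidiagD y1].
apply: ub_le_sup.
  by exists 1 => _ [F [/= LF F1] <-]; exact: phi_le.
exists (mx2 0 (l_ y) (r_ y) 0); last by rewrite phiF0 normr1.
by split; [exact: linking_antidiag|rewrite op_norm_antidiagD y1].
Qed.

(** This bounds the set whose supremum is [Omega x]. Normalizing [x] puts the corner in the unit
    ball, where a state is at most 1. *)
Lemma state_corner_le phi x : rnorm x != 0 -> states phi ->
  normc (phi (mx2 0 0 (r_ x) 0)) <= rnorm x.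
Proof.
move=> x0 [phiD _ phi1]; have xgt : 0 < rnorm x by rewrite lt_def x0 rnorm_ge0.
have V0 : 0 <= (rnorm x)^-1 by rewrite invr_ge0 ltW.
pose y := ((rnorm x)^-1)%:C *: x; pose F := mx2 0 0 (r_ y) (0 : V -> V).
have phi_sup : has_sup [set complex.Re `|phi F| | F in
    [set F | linking F /\ op_norm F <= 1]].
  (* A set without a supremum has [sup] equal to 0, whereas here it is 1. *)
  by apply: contrapT => /sup_out; rewrite phi1 => /eqP; rewrite oner_eq0.
have F1 : normc (phi F) <= 1.
  rewrite -phi1; apply: (ub_le_sup phi_sup.2); exists F => //=.
  split; first exact: linking_corner.
  apply: op_norm_le => // w; rewrite (le_trans (corner_bound _ _))//.
  by rewrite rnormZr// mulVf.
(* Linearity of [phi] holds only on [linking], so [phi 0 = 0] is derived from membership of the zero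
   map. *)
have lin0 : linking (0 : A * V -> A * V).
  rewrite (_ : 0 = mx2 0 0 (r_ 0) 0); first exact: linking_corner.
  by apply/funext => w; rewrite r_0; congr pair; rewrite /= addr0.
have phi0 : phi 0 = 0.
  apply: (addrI (phi 0)); rewrite addr0 -{1}(mul1r (phi 0)) -phiD//.
  by rewrite scaler0 addr0.
have -> : mx2 0 0 (r_ x) 0 = (rnorm x)%:C *: F + 0.
  apply/funext => w; rewrite addr0; congr pair; rewrite /= ?addr0 ?scaler0//.
  by rewrite /r_ ractZl scalerA -rmorphM mulfV// scale1r.
rewrite phiD ?phi0 ?addr0//; last exact: linking_corner.
by rewrite normcM ger0_normc ?rnorm_ge0// ler_piMr ?rnorm_ge0.
Qed.

Lemma half_norm_le_Omega x : rnorm x / 2 <= Omega x.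
Proof.
(* For [x = 0] it suffices that [Omega x] is nonnegative: either a true supremum of nonnegative
   numbers or the default 0. *)
have [x0|x0] := eqVneq (rnorm x) 0.
  rewrite x0 mul0r /Omega; set E := [set _ | _ in _].
  have [[E0 Eub]|/sup_out ->//] := pselect (has_sup E).
  have [z Ez] := E0; rewrite (le_trans _ (ub_le_sup Eub Ez))//.
  by case: Ez => phi _ <-; exact: normc_ge0.
have xgt : 0 < rnorm x by rewrite lt_def x0 rnorm_ge0.
pose y := ((rnorm x)^-1)%:C *: x.
have y1 : rnorm y = 1 by rewrite rnormZr ?invr_ge0 ?rnorm_ge0// mulVf.
have [phi phis phiy] := corner_state y1.
apply: ub_le_sup.
  by exists (rnorm x) => _ [psi /= psis <-]; exact: state_corner_le.
exists phi => //.
have xE : x = (rnorm x)%:C *: y by rewrite scalerA -rmorphM mulfV// scale1r.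
rewrite [in r_ x]xE phiy -[complex.Re _]/(normc _) ger0_normc//.
by rewrite divr_ge0 ?rnorm_ge0.
Qed.

End Operators.

Theorem theorem2p7 (R : realType) (A : cstarAlgType R)
    (A_neq0 : exists a : A, a != 0) (V : hilbertModType A) (x : V) :
  let N := op_norm (mx2 0 (l_ x) (r_ x) 0) in
  let N' := op_norm (mx2 0 (- l_ x) (r_ x) 0) in
  let Gamma := Num.max (rnorm x) N in
  let Gamma' := Num.max (rnorm x) N' in
  let Delta := `|rnorm x - N| in
  let Delta' := `|rnorm x - N'| in
  (1 / 8 * (4 * rnorm x + 2 * `|Gamma - Gamma'| + Delta + Delta') <= Omega x : Prop).
Proof.
(* Both matrix norms are [rnorm x], so the three correction terms vanish and [4 / 8] of the norm
   remains. *)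
rewrite /= op_norm_antidiagD op_norm_antidiagN !subrr normr0.
by have := half_norm_le_Omega x; lra.
Qed.
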